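(* Let $F\in\ell^2(\mathbb Z)$ be supported in $[0,\infty)$ and let $(a,b)$ be its nonlinear Fourier series. Then the layer stripping sequence of $(a,b)$ is $(F_n)_{n\ge0}$, and $(a,b)\in\mathbf H$. Conversely, if $(a,b)\in\mathbf H$, then its layer stripping sequence is square summable and $(a,b)$ is the nonlinear Fourier series of this layer stripping sequence (viewed as a sequence on $\mathbb Z$ supported in $[0,\infty)$).
   Context: $\mathbb T$ is the unit circle, $\mathbb D$ the open unit disc, $\mathbb D^*=\{\overline z^{-1}:z\in\mathbb D\}$, $a^*(z)=\overline{a(\overline z^{-1})}$. $H^2(\mathbb D)$: functions in $L^2(\mathbb T)$ with vanishing negative Fourier coefficients; $H^2(\mathbb D^* )$: $f$ with $f^*\in H^2(\mathbb D)$, and $f(\infty):=\overline{f^*(0)}$. Pairs multiply as $(a,b)(c,d)=(ac-bd^*,ad+bc^* )$, with $y^*=\overline y$ for constants and $(z^k)^*=z^{-k}$. $\mathbf L$: pairs $(a,b)$ of measurable functions on $\mathbb T$ with $aa^*+bb^*=1$ a.e., $a\in H^2(\mathbb D^* )$, $a(\infty)>0$, with metric $\rho((a,b),(c,d))=\|a-c\|_{L^2}+\|b-d\|_{L^2}+|\log a(\infty)-\log c(\infty)|$. $\overline{\mathbf H}$: $(a,b)\in\mathbf L$ with $b\in H^2(\mathbb D)$. $\mathbf H$: $(a,b)\in\overline{\mathbf H}$ such that any inner function $g$ with $a^*g^{-1},bg^{-1}\in H^2(\mathbb D)$ is constant. Nonlinear Fourier series of $F\in\ell^2(\mathbb Z)$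 supported in $[0,\infty)$: the $\rho$-limit in $\mathbf L$ (which exists) of $(a_k,b_k)$, where $(a_0,b_0)=(1+|F_0|^2)^{-1/2}(1,F_0)$ and $(a_k,b_k)=(a_{k-1},b_{k-1})(1+|F_k|^2)^{-1/2}(1,F_kz^k)$. Layer stripping sequence of $(a,b)\in\overline{\mathbf H}$: set $(a_0,b_0)=(a,b)$ and recursively $(a_{n+1}(z),b_{n+1}(z)z)=(1+|F_n|^2)^{-1/2}(1,-F_n)(a_n(z),b_n(z))$, where $F_n\in\mathbb C$ is the unique number for which $(a_{n+1},b_{n+1})\in\overline{\mathbf H}$ (explicitly $F_n=b_n(0)/a_n^*(0)$); the layer stripping sequence is $(F_n)_{n\ge0}$. *)

(* Defs.v *)
From HB Require Import structures.
From mathcomp Require Import all_boot all_order all_algebra.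
From mathcomp Require Import all_classical all_reals all_analysis.
From mathcomp Require Import complex.

Set Implicit Arguments.
Unset Strict Implicit.
Unset Printing Implicit Defensive.

Import Order.TTheory GRing.Theory Num.Theory.
Import numFieldNormedType.Exports.
Local Open Scope classical_set_scope.
Local Open Scope ring_scope.

(* Functions on the unit circle T are represented through the angle:
   f : R -> R[i], with f theta standing for the value at e^{i theta};
   only the values on [0, 2 pi] matter (all notions below only look there,
   and "a.e." refers to Lebesgue measure on [0, 2 pi]). *)

Section Defs.
Variable R : realType.
Local Notation C := (complex R).

Definition cconj (z : C) : C := @Complex R (complex.Re z) (- complex.Im z).
Definition csq (z : C) : R := complex.Re z ^+ 2 + complex.Im z ^+ 2.
Definition cexpi (t : R) : C := @Complex R (cos t) (sin t).
Definition expk (k : int) (t : R) : C := cexpi (k%:~R * t).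

Definition circ : set R := `[0, 2 * pi]%classic.
Definition leb := (@lebesgue_measure R).

Definition cmeasurable (f : R -> C) : Prop :=
  measurable_fun circ (fun t => complex.Re (f t)) /\
  measurable_fun circ (fun t => complex.Im (f t)).

Definition L2 (f : R -> C) : Prop :=
  cmeasurable f /\
  (\int[leb]_(t in circ) (csq (f t))%:E < +oo)%E.

Definition L2norm (f : R -> C) : R :=
  Num.sqrt ((2 * pi)^-1 * Rintegral leb circ (fun t => csq (f t))).

Definition fcoef (f : R -> C) (k : int) : C :=
  let g := fun t => f t * expk (- k) t in
  @Complex R ((2 * pi)^-1 * Rintegral leb circ (fun t => complex.Re (g t)))
          ((2 * pi)^-1 * Rintegral leb circ (fun t => complex.Im (g t))).

(* the star operation: on T, a^star(z) = conj(a(conj(z)^{-1})) = conj(a(z)) *)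
Definition fstar (f : R -> C) : R -> C := fun t => cconj (f t).

Definition H2D (f : R -> C) : Prop :=
  L2 f /\ forall k : int, k < 0 -> fcoef f k = 0.
Definition H2Dstar (f : R -> C) : Prop := H2D (fstar f).

(* value at 0 of f in H^2(D), value at infinity of f in H^2(D^star) *)
Definition at0 (f : R -> C) : C := fcoef f 0.
Definition at_infty (f : R -> C) : C := cconj (at0 (fstar f)).

Definition ae_circ (P : R -> Prop) : Prop :=
  {ae leb, forall t, circ t -> P t}.

Definition pair := ((R -> C) * (R -> C))%type.

Definition pmul (p q : pair) : pair :=
  (fun t => p.1 t * q.1 t - p.2 t * cconj (q.2 t),
   fun t => p.1 t * q.2 t + p.2 t * cconj (q.1 t)).

Definition pscale (c : R) (p : pair) : pair :=
  (fun t => @Complex R c 0 * p.1 t, fun t => @Complex R c 0 * p.2 t).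

Definition cst (z : C) : R -> C := fun _ => z.

Definition inL (p : pair) : Prop :=
  cmeasurable p.1 /\ cmeasurable p.2 /\
  ae_circ (fun t => p.1 t * cconj (p.1 t) + p.2 t * cconj (p.2 t) = 1) /\
  H2Dstar p.1 /\
  complex.Im (at_infty p.1) = 0 /\ 0 < complex.Re (at_infty p.1).

Definition rho (p q : pair) : R :=
  L2norm (fun t => p.1 t - q.1 t) + L2norm (fun t => p.2 t - q.2 t)
  + `| ln (complex.Re (at_infty p.1)) - ln (complex.Re (at_infty q.1)) |.

Definition inHbar (p : pair) : Prop := inL p /\ H2D p.2.

(* inner function, described by its boundary values: a bounded analytic
   function on D (here: in H^2(D)) with unimodular boundary values a.e. *)
Definition inner (g : R -> C) : Prop :=
  H2D g /\ ae_circ (fun t => csq (g t) = 1).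

Definition const_ae (g : R -> C) : Prop :=
  exists c : C, ae_circ (fun t => g t = c).

Definition inH (p : pair) : Prop :=
  inHbar p /\
  forall g, inner g ->
    H2D (fun t => fstar p.1 t / g t) -> H2D (fun t => p.2 t / g t) ->
    const_ae g.

Definition sqsum (F : nat -> C) : Prop :=
  cvgn (series (fun n => csq (F n))).

Definition nfactor (z : C) : R := Num.sqrt (1 + csq z)^-1.

Fixpoint nlf_partial (F : nat -> C) (k : nat) : pair :=
  match k with
  | 0 => pscale (nfactor (F 0)) (cst 1, cst (F 0))
  | k'.+1 => pmul (nlf_partial F k')
      (pscale (nfactor (F k)) (cst 1, fun t => F k * expk k%:Z t))
  end.

Definition is_NLFS (F : nat -> C) (p : pair) : Prop :=
  inL p /\ (fun k => rho (nlf_partial F k) p) @ \oo --> (0 : R).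

Definition strip_coef (p : pair) : C := at0 p.2 / at0 (fstar p.1).

Definition strip_step (p : pair) : pair :=
  let Fn := strip_coef p in
  let q := pscale (nfactor Fn) (pmul (cst 1, cst (- Fn)) p) in
  (q.1, fun t => q.2 t * expk (-1) t).

Fixpoint strip_pair (p : pair) (n : nat) : pair :=
  match n with 0 => p | n'.+1 => strip_step (strip_pair p n') end.

Definition layer_strip (p : pair) (n : nat) : C := strip_coef (strip_pair p n).

End Defs.

(* Main.v *)
Require Import Defs.
From HB Require Import structures.
From mathcomp Require Import all_boot all_order all_algebra.
From mathcomp Require Import all_classical all_reals all_analysis.
From mathcomp Require Import complex measurable_realfun ring lra zify.

(** Write A = a^* and let G_n be the product of the first n factors of a
sequence F.

Analytic part. A bounded measurable function whose product with every function
with vanishing Fourier coefficients again has vanishing Fourier coefficients is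
called a multiplier; multipliers form an algebra containing the exponentials,
hence the functions (1 - y^n)^(2^n) with y affine in cos(t - x0), which converge
boundedly to the indicator function of an arc. So a function with vanishing
Fourier coefficients integrates to 0 over every arc and vanishes a.e. With the
completeness of L^2 this makes functions in H^2(D) limits of their Taylor
polynomials, and evaluation at 0 multiplicative on H^2(D).

Stripping multiplies A(0) by (1 + |F_n|^2)^(1/2), and |A_n(0)| <= 1; this bounds
prod (1 + |F_n|^2). For SU(2)-valued p and q, the squared L^2 distance is
2 - 2 Re of the mean of the first entry of q^-1 p.

If (a, b) is the series of F, then F_n is read off the lowest frequency of
G_n^-1 (a, b). If g is inner and divides A and b, then (A/g, b/g) has the same
stripping sequence, so |(A/g)(0)| <= prod (1 + |F_n|^2)^(-1/2) = A(0), hence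
|g(0)| >= 1 and g is constant.

Conversely, the pairs G_n^-1 (a, b) = (a_n, b_n z^n) form a Cauchy sequence. All
Fourier coefficients of the limit of b_n z^n vanish, so the limit is (c, 0) with
c^* inner, and A / c^* and b / c^* are limits of polynomials. If (a, b) is in H,
then c^* is the constant 1, so A_n(0) -> 1, which says that G_n -> (a, b). *)

Set Implicit Arguments.
Unset Strict Implicit.
Unset Printing Implicit Defensive.

Import Order.TTheory GRing.Theory Num.Theory.
Import numFieldNormedType.Exports.
Local Open Scope classical_set_scope.
Local Open Scope ring_scope.

(** * Complex numbers and means over the circle *)


Section ComplexParts.
Variable R : realType.
Local Notation C := (complex R).
Implicit Types z w : C.

(** Two numbers compete: A(0) and the infinite product of the factors (1 + |F_n|^2)^(-1/2). For
    every pair of the closed class A(0) is at most the product, and the quotient of the two is the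
    value at 0 of the inner function c^* that survives infinitely many strippings. L^2 convergence
    of the partial products to the pair means that the quotient is 1. The logarithmic term of [rho]
    forces this for a nonlinear Fourier series; membership in H forces it by making c^* constant,
    and positivity of a at infinity then fixes its phase.

    A product of two functions in H^2(D) is in general only integrable. Here one factor is always
    bounded by 1, because the entries of a unitary pair and inner functions are. Multiplication by
    such a factor is a contraction of L^2, so every limit can be taken in L^2. Distances are kept
    squared, since in this form multiplication by a unitary pair is an isometry at each point of the
    circle. *)

Lemma cext z w : complex.Re z = complex.Re w -> complex.Im z = complex.Im w ->
  z = w.
Proof. by case: z w => [a b] [c d] /= -> ->. Qed.

Lemma cReD z w : complex.Re (z + w) = complex.Re z + complex.Re w.
Proof. by case: z w => [a b] [c d]. Qed.
Lemma cImD z w : complex.Im (z + w) = complex.Im z + complex.Im w.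
Proof. by case: z w => [a b] [c d]. Qed.
Lemma cReN z : complex.Re (- z) = - complex.Re z.
Proof. by case: z. Qed.
Lemma cImN z : complex.Im (- z) = - complex.Im z.
Proof. by case: z. Qed.
Lemma cReM z w : complex.Re (z * w) =
  complex.Re z * complex.Re w - complex.Im z * complex.Im w.
Proof. by case: z w => [a b] [c d]. Qed.
Lemma cImM z w : complex.Im (z * w) =
  complex.Re z * complex.Im w + complex.Im z * complex.Re w.
Proof. by case: z w => [a b] [c d]. Qed.
Lemma cRe_conj z : complex.Re (cconj z) = complex.Re z.
Proof. by []. Qed.
Lemma cIm_conj z : complex.Im (cconj z) = - complex.Im z.
Proof. by []. Qed.
Lemma cRe0 : complex.Re (0 : C) = 0. Proof. by []. Qed.
Lemma cIm0 : complex.Im (0 : C) = 0. Proof. by []. Qed.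
Lemma cRe1 : complex.Re (1 : C) = 1. Proof. by []. Qed.
Lemma cIm1 : complex.Im (1 : C) = 0. Proof. by []. Qed.

Definition reimE := (cReD, cImD, cReN, cImN, cReM, cImM, cRe_conj, cIm_conj,
  cRe0, cIm0, cRe1, cIm1).

Lemma cconjD z w : cconj (z + w) = cconj z + cconj w.
Proof. by apply: cext; rewrite !reimE //; ring. Qed.
Lemma cconjN z : cconj (- z) = - cconj z.
Proof. by apply: cext; rewrite !reimE. Qed.
Lemma cconjM z w : cconj (z * w) = cconj z * cconj w.
Proof. by apply: cext; rewrite !reimE; ring. Qed.
Lemma cconjK z : cconj (cconj z) = z.
Proof. by apply: cext; rewrite !reimE // opprK. Qed.
Lemma cconj0 : cconj (0 : C) = 0.
Proof. by apply: cext; rewrite !reimE // oppr0. Qed.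
Lemma cconj1 : cconj (1 : C) = 1.
Proof. by apply: cext; rewrite !reimE // oppr0. Qed.
Lemma cconj_real (r : R) : cconj (Complex r 0) = Complex r 0.
Proof. by apply: cext; rewrite /= ?oppr0. Qed.

Lemma csqM z w : csq (z * w) = csq z * csq w.
Proof. by rewrite /csq !reimE; ring. Qed.
Lemma csq_conj z : csq (cconj z) = csq z.
Proof. by rewrite /csq !reimE; ring. Qed.
Lemma csqN z : csq (- z) = csq z.
Proof. by rewrite /csq !reimE; ring. Qed.
Lemma csq_ge0 z : 0 <= csq z.
Proof. by rewrite /csq addr_ge0 // sqr_ge0. Qed.
Lemma csq0 : csq (0 : C) = 0.
Proof. by rewrite /csq !reimE; ring. Qed.
Lemma csq1 : csq (1 : C) = 1.
Proof. by rewrite /csq !reimE; ring. Qed.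
Lemma csq_real (r : R) : csq (Complex r 0) = r ^+ 2.
Proof. by rewrite /csq /=; ring. Qed.

Lemma csq_eq0 z : csq z = 0 -> z = 0.
Proof.
rewrite /csq => /eqP; rewrite paddr_eq0 ?sqr_ge0 // !sqrf_eq0.
by case/andP=> /eqP h1 /eqP h2; apply: cext.
Qed.

Lemma csq_gt0 z : z != 0 -> 0 < csq z.
Proof.
move=> z0; rewrite lt_neqAle csq_ge0 andbT; apply/eqP => h.
by move/eqP: z0; apply; apply: csq_eq0.
Qed.

Lemma mul_cconj z : z * cconj z = Complex (csq z) 0.
Proof. by apply: cext; rewrite !reimE /csq /=; ring. Qed.

Lemma Re_sq_le_csq z : complex.Re z ^+ 2 <= csq z.
Proof. by rewrite /csq lerDl sqr_ge0. Qed.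
Lemma Im_sq_le_csq z : complex.Im z ^+ 2 <= csq z.
Proof. by rewrite /csq lerDr sqr_ge0. Qed.

Lemma csqD_le z w : csq (z + w) <= 2 * csq z + 2 * csq w.
Proof.
rewrite /csq !reimE.
have := sqr_ge0 (complex.Re z - complex.Re w).
have := sqr_ge0 (complex.Im z - complex.Im w).
rewrite -subr_ge0 => h1 h2; rewrite -subr_ge0.
apply: le_trans (addr_ge0 h1 h2) _; rewrite le_eqVlt; apply/orP; left.
by apply/eqP; ring.
Qed.

Lemma csq_div z w : w != 0 -> csq (z / w) = csq z / csq w.
Proof.
move=> w0; have h := csq_gt0 w0.
by apply: (mulIf (lt0r_neq0 h)); rewrite -csqM divfK // divfK // lt0r_neq0.
Qed.

Lemma cinv_unimodular z : csq z = 1 -> z^-1 = cconj z.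
Proof.
move=> h; have z0 : z != 0.
  by apply/eqP => z0; move/eqP: h; rewrite z0 csq0 eq_sym oner_eq0.
apply: (mulfI z0); rewrite mulfV // mul_cconj h //.
Qed.

Lemma csq_cexpi (t : R) : csq (cexpi t) = 1.
Proof. by rewrite /csq /= cos2Dsin2. Qed.
Lemma csq_expk k (t : R) : csq (expk k t) = 1.
Proof. exact: csq_cexpi. Qed.

Lemma expkD (k l : int) (t : R) : expk (k + l) t = expk k t * expk l t.
Proof.
rewrite /expk intrD mulrDl; apply: cext; rewrite !reimE /= ?cosD ?sinD //.
by ring.
Qed.
Lemma expk0 (t : R) : expk 0 t = 1 :> C.
Proof. by rewrite /expk mul0r; apply: cext; rewrite /= ?cos0 ?sin0. Qed.
Lemma cconj_expk k (t : R) : cconj (expk k t) = expk (- k) t.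
Proof.
by rewrite /expk intrN mulNr; apply: cext; rewrite /= ?cosN ?sinN.
Qed.
Lemma expkNK k (t : R) : expk (- k) t * expk k t = 1.
Proof. by rewrite -expkD addNr expk0. Qed.

End ComplexParts.

(** * Real means over the circle *)

Section Means.
Variable R : realType.
Local Notation C := (complex R).
Local Notation mu := (@lebesgue_measure R).
Local Notation D := (@circ R).
Implicit Types f g : R -> R.

Lemma pi2_gt0 : 0 < 2 * pi :> R.
Proof. by rewrite mulr_gt0 // pi_gt0. Qed.

Lemma mcirc : measurable (D : set (measurableTypeR R)). Proof. exact: measurable_itv. Qed.
Hint Resolve mcirc : core.

Definition rmeas f := @measurable_fun _ _ (measurableTypeR R) R D f.

Lemma rmeasP f : rmeas f <-> measurable_fun D f.
Proof. by []. Qed.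

Lemma mu_circ : mu D = (2 * pi)%:E.
Proof. by rewrite lebesgue_measure_itv /= lte_fin pi2_gt0 sube0. Qed.

Definition ig f := mu.-integrable D (EFin \o f).
Definition rmean f := (2 * pi)^-1 * Rintegral mu D f.

Lemma ig_meas f : ig f -> rmeas f.
Proof. by move/measurable_int/measurable_EFinP. Qed.

Lemma igD f g : ig f -> ig g -> ig (fun t => f t + g t).
Proof. move=> hf hg; exact: (integrableD mcirc hf hg). Qed.
Lemma igN f : ig f -> ig (fun t => - f t).
Proof. move=> hf; exact: (integrableN hf). Qed.
Lemma igB f g : ig f -> ig g -> ig (fun t => f t - g t).
Proof. by move=> hf hg; apply: igD => //; apply: igN. Qed.
Lemma igZ c f : ig f -> ig (fun t => c * f t).
Proof. move=> hf; exact: (integrableZl mcirc c hf). Qed.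
Lemma ig_cst c : ig (fun=> c).
Proof.
apply: measurable_bounded_integrable; [exact: mcirc|exact: (eq_ind_r (fun x => (x < +oo)%E) (ltry _) mu_circ)|exact: measurable_cst|].
exists `|c|; split; first exact: num_real.
by move=> x hx t _ /=; exact: ltW.
Qed.
Lemma ig_le f g : rmeas f -> (forall t, D t -> `|f t| <= g t) ->
  ig g -> ig f.
Proof.
move=> mf h; apply: le_integrable; [exact: mcirc|exact/measurable_EFinP|].
move=> t Dt /=; rewrite lee_fin; apply: (le_trans (h _ Dt)); exact: ler_norm.
Qed.

Lemma rmeanD f g : ig f -> ig g -> rmean (fun t => f t + g t) = rmean f + rmean g.
Proof. by move=> hf hg; rewrite /rmean (RintegralD mcirc hf hg) mulrDr. Qed.
Lemma rmeanZ c f : ig f -> rmean (fun t => c * f t) = c * rmean f.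
Proof. by move=> hf; rewrite /rmean (RintegralZl c mcirc hf) mulrCA. Qed.
Lemma rmeanN f : ig f -> rmean (fun t => - f t) = - rmean f.
Proof.
move=> hf; rewrite -mulN1r -rmeanZ //; congr rmean.
by apply/funext => t; rewrite mulN1r.
Qed.
Lemma rmeanB f g : ig f -> ig g -> rmean (fun t => f t - g t) = rmean f - rmean g.
Proof. by move=> hf hg; rewrite rmeanD ?rmeanN //; apply: igN. Qed.
Lemma rmean_cst c : rmean (fun=> c) = c.
Proof.
rewrite /rmean (Rintegral_cst mu mcirc c) (congr1 fine mu_circ) /= mulrCA mulVf ?mulr1 //.
by rewrite lt0r_neq0 ?pi2_gt0.
Qed.
Lemma rmean_ge0 f : (forall t, D t -> 0 <= f t) -> 0 <= rmean f.
Proof.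
move=> h; rewrite mulr_ge0 ?invr_ge0 ?(ltW pi2_gt0) //; exact: Rintegral_ge0.
Qed.
Lemma rmean_le f g : ig f -> ig g -> (forall t, D t -> f t <= g t) ->
  rmean f <= rmean g.
Proof.
move=> hf hg h; rewrite ler_pM2l ?invr_gt0 ?pi2_gt0 //.
exact: (le_Rintegral mcirc hf hg).
Qed.

Lemma ae_circS (P Q : R -> Prop) : (forall t, D t -> P t -> Q t) ->
  ae_circ P -> ae_circ Q.
Proof.
move=> PQ; apply: (@filterS _ _ (ae_filter_ringOfSetsType mu)) => t h Dt.
exact/PQ/h.
Qed.

Lemma ae_circS2 (P1 P2 Q : R -> Prop) : (forall t, D t -> P1 t -> P2 t -> Q t) ->
  ae_circ P1 -> ae_circ P2 -> ae_circ Q.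
Proof.
move=> PQ; apply: (@filterS2 _ _ (ae_filter_ringOfSetsType mu)) => t h1 h2 Dt.
exact: (PQ _ Dt (h1 Dt) (h2 Dt)).
Qed.

Lemma ae_circW (P : R -> Prop) : (forall t, P t) -> ae_circ P.
Proof. by move=> h; apply: aeW => t _. Qed.

Lemma rmean_ae f g : rmeas f -> rmeas g ->
  ae_circ (fun t => f t = g t) -> rmean f = rmean g.
Proof.
move=> mf mg h; congr (_ * fine _).
have m1 : @measurable_fun _ _ (measurableTypeR R) _ D (EFin \o f).
  exact/measurable_EFinP.
have m2 : @measurable_fun _ _ (measurableTypeR R) _ D (EFin \o g).
  exact/measurable_EFinP.
apply: (ae_eq_integral _ _ mcirc m1 m2).
by apply: ae_circS h => t Dt /= ->.
Qed.

Lemma ig_ae f g : rmeas g -> ig f ->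
  ae_circ (fun t => f t = g t) -> ig g.
Proof.
move=> mg hf h; apply/integrableP; split; first exact/measurable_EFinP.
have /integrableP[mf hlt] := hf.
have m1 : @measurable_fun _ _ (measurableTypeR R) _ D (fun t => `|(EFin \o f) t|)%E.
  exact: measurableT_comp.
have m2 : @measurable_fun _ _ (measurableTypeR R) _ D (fun t => `|(EFin \o g) t|)%E.
  by apply: measurableT_comp => //; exact/measurable_EFinP.
rewrite -(@ae_eq_integral _ _ _ mu D _ _ mcirc m1 m2) //.
by apply: ae_circS h => t Dt /= ->.
Qed.

(** The domination holds only almost everywhere, so |f| is first truncated at g. The truncation is
    bounded by |g| at every point and agrees almost everywhere with |f|. *)
Lemma ig_ae_le f g : rmeas f -> ae_circ (fun t => `|f t| <= g t) ->
  ig g -> ig f.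
Proof.
move=> mf h hg; have mg := ig_meas hg.
have : ig (fun t => Num.min `|f t| (g t)).
  apply: (@ig_le _ (fun t => `|g t|)).
  - apply: measurable_minr => //; exact: measurableT_comp.
  - move=> t _; case: (leP `|f t| (g t)) => hfg.
      by rewrite normr_id (le_trans hfg) // ler_norm.
    by [].
  - exact: integrable_norm.
move/(@ig_ae _ (fun t => `|f t|)) => h1.
have {}h1 : ig (fun t => `|f t|).
  apply: h1; first exact: measurableT_comp.
  by apply: ae_circS h => t Dt h; rewrite min_l.
by apply: ig_le h1 => // t _.
Qed.

Lemma rmean_ae_le f g : ig f -> ig g -> ae_circ (fun t => f t <= g t) ->
  rmean f <= rmean g.
Proof.
move=> hf hg h.
rewrite (@rmean_ae f (fun t => Num.min (f t) (g t))).
- apply: rmean_le => //.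
    apply: (ig_ae _ hf).
      by apply: measurable_minr; exact: ig_meas.
    by apply: ae_circS h => t Dt h; rewrite min_l.
  by move=> t _; rewrite ge_min lexx orbT.
- exact: ig_meas.
- by apply: measurable_minr; exact: ig_meas.
- by apply: ae_circS h => t Dt h; rewrite min_l.
Qed.

Lemma rmean_eq0 f : ig f -> (forall t, D t -> 0 <= f t) -> rmean f = 0 ->
  ae_circ (fun t => f t = 0).
Proof.
move=> hf f0 /eqP; rewrite mulf_eq0 invr_eq0 (negbTE (lt0r_neq0 pi2_gt0)) /=.
move=> /eqP h.
have : (\int[mu]_(t in D) `|(f t)%:E| = 0)%E.
  rewrite (_ : (\int[mu]_(t in D) `|(f t)%:E|) = (\int[mu]_(t in D) (f t)%:E))%E.
    rewrite -[LHS]fineK; last exact: (integrable_fin_num mcirc hf).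
    by rewrite -[X in X%:E]/(Rintegral mu D f) h.
  by apply: eq_integral => t /set_mem Dt; rewrite gee0_abs // lee_fin f0.
move/(ae_eq_integral_abs _ mcirc) => h1.
have mf : @measurable_fun _ _ (measurableTypeR R) _ D (EFin \o f) by exact: measurable_int hf.
by apply: ae_circS (h1 mf) => t Dt [].
Qed.

End Means.


(** * Complex means, square integrable functions and Fourier coefficients *)

Section ComplexMeans.
Variable R : realType.
Local Notation C := (complex R).
Local Notation mu := (@lebesgue_measure R).
Local Notation D := (@circ R).
Implicit Types f g h : R -> C.

Definition cint f := ig (fun t => complex.Re (f t)) /\ ig (fun t => complex.Im (f t)).
Definition cmean f : C :=
  Complex (rmean (fun t => complex.Re (f t))) (rmean (fun t => complex.Im (f t))).
Definition nsq f : R := rmean (fun t => csq (f t)).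

Lemma fcoefE f k : fcoef f k = cmean (fun t => f t * expk (- k) t).
Proof. by []. Qed.

Lemma L2normE f : L2norm f = Num.sqrt (nsq f).
Proof. by []. Qed.

Lemma cmeasD f g : cmeasurable f -> cmeasurable g ->
  cmeasurable (fun t => f t + g t).
Proof.
move=> [f1 f2] [g1 g2]; split.
  by under eq_fun do rewrite cReD; apply: measurable_funD.
by under eq_fun do rewrite cImD; apply: measurable_funD.
Qed.

Lemma cmeasN f : cmeasurable f -> cmeasurable (fun t => - f t).
Proof.
move=> [f1 f2]; split.
  by under eq_fun do rewrite cReN; apply: measurableT_comp.
by under eq_fun do rewrite cImN; apply: measurableT_comp.
Qed.

Lemma cmeasB f g : cmeasurable f -> cmeasurable g ->
  cmeasurable (fun t => f t - g t).
Proof. by move=> hf hg; apply: cmeasD => //; apply: cmeasN. Qed.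

Lemma cmeasM f g : cmeasurable f -> cmeasurable g ->
  cmeasurable (fun t => f t * g t).
Proof.
move=> [f1 f2] [g1 g2]; split.
  by under eq_fun do rewrite cReM; apply: measurable_funB; apply: measurable_funM.
by under eq_fun do rewrite cImM; apply: measurable_funD; apply: measurable_funM.
Qed.

Lemma cmeas_cst (c : C) : cmeasurable (fun=> c).
Proof. by split; exact: measurable_cst. Qed.

Lemma cmeas_conj f : cmeasurable f -> cmeasurable (fun t => cconj (f t)).
Proof. by move=> [f1 f2]; split => //=; apply: measurableT_comp. Qed.

Lemma cmeas_expk k : cmeasurable (@expk R k).
Proof.
split => /=.
  apply: measurable_funTS; apply: (@measurableT_comp _ _ _ _ _ _ (@cos R)).
    by apply: continuous_measurable_fun; exact: continuous_cos.
  by apply: measurable_funM.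
apply: measurable_funTS; apply: (@measurableT_comp _ _ _ _ _ _ (@sin R)).
  by apply: continuous_measurable_fun; exact: continuous_sin.
by apply: measurable_funM.
Qed.

Lemma rmeas_csq f : cmeasurable f -> rmeas (fun t => csq (f t)).
Proof.
move=> [f1 f2]; apply/rmeasP; apply: measurable_funD.
  exact: measurable_funX.
exact: measurable_funX.
Qed.

Lemma cint_meas f : cint f -> cmeasurable f.
Proof. by move=> [/ig_meas f1 /ig_meas f2]. Qed.

Lemma L2P f : L2 f <-> cmeasurable f /\ ig (fun t => csq (f t)).
Proof.
split=> -[mf hf]; split=> //.
  apply/integrableP; split.
    by apply/measurable_EFinP; exact: rmeas_csq.
  rewrite (_ : (\int[mu]_(t in D) _)%E = (\int[mu]_(t in D) (csq (f t))%:E)%E) //.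
  by apply: eq_integral => t _; rewrite /= ger0_norm // csq_ge0.
have hf' : mu.-integrable D (EFin \o (fun t => csq (f t))) by exact: hf.
by have := integrable_lty (@mcirc R) hf'.
Qed.

Lemma L2_meas f : L2 f -> cmeasurable f. Proof. by case. Qed.
Lemma L2_ig f : L2 f -> ig (fun t => csq (f t)).
Proof. by move/L2P => []. Qed.

Lemma cintD f g : cint f -> cint g -> cint (fun t => f t + g t).
Proof.
move=> [f1 f2] [g1 g2]; split.
  by under eq_fun do rewrite cReD; apply: igD.
by under eq_fun do rewrite cImD; apply: igD.
Qed.

Lemma cintZ c f : cint f -> cint (fun t => c * f t).
Proof.
move=> [f1 f2]; split.
  by under eq_fun do rewrite cReM; apply: igB; apply: igZ.
by under eq_fun do rewrite cImM; apply: igD; apply: igZ.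
Qed.

Lemma cmeanD f g : cint f -> cint g ->
  cmean (fun t => f t + g t) = cmean f + cmean g.
Proof.
move=> [f1 f2] [g1 g2]; apply: cext; rewrite !reimE /= -rmeanD //; congr rmean;
  by apply/funext => t; rewrite !reimE.
Qed.

Lemma cmeanZ c f : cint f -> cmean (fun t => c * f t) = c * cmean f.
Proof.
move=> [f1 f2]; apply: cext; rewrite !reimE /= -!rmeanZ // -?rmeanD -?rmeanB //;
  try exact: igZ; congr rmean; by apply/funext => t; rewrite !reimE.
Qed.

Lemma cmeanN f : cint f -> cmean (fun t => - f t) = - cmean f.
Proof.
move=> hf; rewrite -mulN1r -cmeanZ //; congr cmean.
by apply/funext => t; rewrite mulN1r.
Qed.

Lemma cintN f : cint f -> cint (fun t => - f t).
Proof.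
move=> hf; have := cintZ (-1) hf.
by under eq_fun do rewrite mulN1r.
Qed.

Lemma cmeanB f g : cint f -> cint g ->
  cmean (fun t => f t - g t) = cmean f - cmean g.
Proof. by move=> hf hg; rewrite cmeanD ?cmeanN //; apply: cintN. Qed.

Lemma cmean_cst (c : C) : cmean (fun=> c) = c.
Proof. by apply: cext; rewrite /= rmean_cst. Qed.

Lemma cmean_conj f : cint f -> cmean (fun t => cconj (f t)) = cconj (cmean f).
Proof. by move=> [f1 f2]; apply: cext; rewrite //= rmeanN. Qed.

Lemma cmean_ae f g : cmeasurable f -> cmeasurable g ->
  ae_circ (fun t => f t = g t) -> cmean f = cmean g.
Proof.
move=> [f1 f2] [g1 g2] h; apply: cext; apply: rmean_ae => //;
  by apply: ae_circS h => t _ ->.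
Qed.

Lemma L2_ae f g : cmeasurable g -> L2 f -> ae_circ (fun t => f t = g t) -> L2 g.
Proof.
move=> mg /L2P [mf hf] h; apply/L2P; split => //.
by apply: (ig_ae _ hf); [exact: rmeas_csq|apply: ae_circS h => t _ ->].
Qed.

(** A crude form of the arithmetic-geometric inequality. It only serves to make the product of two
    square integrable functions integrable, so the constant is not optimized. *)
Lemma norm_ReM_le (z w : C) : `|complex.Re (z * w)| <= csq z + csq w.
Proof.
rewrite cReM ler_norml /csq.
have := sqr_ge0 (complex.Re z + complex.Re w).
have := sqr_ge0 (complex.Re z - complex.Re w).
have := sqr_ge0 (complex.Im z + complex.Im w).
have := sqr_ge0 (complex.Im z - complex.Im w).
have := sqr_ge0 (complex.Re z).
have := sqr_ge0 (complex.Re w).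
have := sqr_ge0 (complex.Im z).
have := sqr_ge0 (complex.Im w).
by rewrite !sqrrD !sqrrN => *; apply/andP; split; lra.
Qed.

Lemma norm_ImM_le (z w : C) : `|complex.Im (z * w)| <= csq z + csq w.
Proof.
(* Multiplication by -i turns the imaginary part into a real part. *)
have := norm_ReM_le z (w * Complex 0 (-1)).
rewrite csqM (_ : csq (Complex 0 (-1)) = 1); last by rewrite /csq /=; ring.
by rewrite mulr1 mulrA [X in `|X|]cReM /= mulr0 sub0r mulrN1 opprK.
Qed.

Lemma cintM f g : L2 f -> L2 g -> cint (fun t => f t * g t).
Proof.
move=> /L2P[mf hf] /L2P[mg hg].
have [m1 m2] := cmeasM mf mg.
have hs : ig (fun t => `|csq (f t) + csq (g t)|) by exact/integrable_norm/igD.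
split; apply: (ig_le _ _ (igD hf hg)) => // t _.
  exact: norm_ReM_le.
exact: norm_ImM_le.
Qed.

Lemma L2_cst (c : C) : L2 (fun=> c).
Proof. by apply/L2P; split; [exact: cmeas_cst|exact: ig_cst]. Qed.

Lemma L2_bounded f (M : R) : cmeasurable f -> ae_circ (fun t => csq (f t) <= M) ->
  L2 f.
Proof.
move=> mf h; apply/L2P; split => //.
apply: (@ig_ae_le _ _ (fun=> M)); [exact: rmeas_csq| |exact: ig_cst].
by apply: ae_circS h => t _; rewrite ger0_norm // csq_ge0.
Qed.

Lemma L2_expk k : L2 (@expk R k).
Proof.
apply: (@L2_bounded _ 1); first exact: cmeas_expk.
by apply: ae_circW => t; rewrite csq_expk.
Qed.

Lemma cint_L2 f : L2 f -> cint f.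
Proof.
move=> hf; have := cintM hf (L2_cst 1).
by under eq_fun do rewrite mulr1.
Qed.

Lemma L2D f g : L2 f -> L2 g -> L2 (fun t => f t + g t).
Proof.
move=> /L2P[mf hf] /L2P[mg hg]; apply/L2P; split; first exact: cmeasD.
have := igD (igZ 2 hf) (igZ 2 hg); apply: ig_le.
  by apply: rmeas_csq; exact: cmeasD.
move=> t _; rewrite ger0_norm ?csq_ge0 //; exact: csqD_le.
Qed.

Lemma L2M_bounded f g (M : R) : cmeasurable f ->
  ae_circ (fun t => csq (f t) <= M) -> L2 g -> L2 (fun t => f t * g t).
Proof.
move=> mf h /L2P[mg hg]; apply/L2P; split; first exact: cmeasM.
apply: (ig_ae_le _ _ (igZ M hg)); first by apply: rmeas_csq; exact: cmeasM.
apply: ae_circS h => t _ h; rewrite ger0_norm ?csq_ge0 // csqM.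
by apply: ler_wpM2r => //; exact: csq_ge0.
Qed.

Lemma L2Z c f : L2 f -> L2 (fun t => c * f t).
Proof.
apply: (@L2M_bounded _ _ (csq c)); first exact: cmeas_cst.
exact: ae_circW.
Qed.

Lemma L2N f : L2 f -> L2 (fun t => - f t).
Proof. by move=> /(L2Z (-1)); under eq_fun do rewrite mulN1r. Qed.

Lemma L2B f g : L2 f -> L2 g -> L2 (fun t => f t - g t).
Proof. by move=> hf hg; apply: L2D => //; apply: L2N. Qed.

Lemma L2_conj f : L2 f -> L2 (fun t => cconj (f t)).
Proof.
move=> /L2P[mf hf]; apply/L2P; split; first exact: cmeas_conj.
by under eq_fun do rewrite csq_conj.
Qed.

Lemma L2_expkM k f : L2 f -> L2 (fun t => f t * expk k t).
Proof.
move=> hf; under eq_fun do rewrite mulrC.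
apply: (@L2M_bounded _ _ 1) => //; first exact: cmeas_expk.
by apply: ae_circW => t; rewrite csq_expk.
Qed.

Lemma nsq_ge0 f : 0 <= nsq f.
Proof. by apply: rmean_ge0 => t _; exact: csq_ge0. Qed.

Lemma nsqD f g : L2 f -> L2 g -> nsq (fun t => f t + g t) <= 2 * nsq f + 2 * nsq g.
Proof.
move=> hf hg; rewrite /nsq -!rmeanZ ?L2_ig // -rmeanD; try by apply: igZ; exact: L2_ig.
apply: rmean_le; first by apply: L2_ig; exact: L2D.
  by apply: igD; apply: igZ; exact: L2_ig.
by move=> t _; exact: csqD_le.
Qed.

Lemma nsqN f : nsq (fun t => - f t) = nsq f.
Proof. by rewrite /nsq; under eq_fun do rewrite csqN. Qed.

Lemma nsq_ae f g : cmeasurable f -> cmeasurable g ->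
  ae_circ (fun t => f t = g t) -> nsq f = nsq g.
Proof.
move=> mf mg h; apply: rmean_ae; try exact: rmeas_csq.
by apply: ae_circS h => t _ ->.
Qed.

Lemma nsq_eq0 f : L2 f -> nsq f = 0 -> ae_circ (fun t => f t = 0).
Proof.
move=> hf h; have := rmean_eq0 (L2_ig hf) (fun t _ => csq_ge0 (f t)) h.
by apply: ae_circS => t _; exact: csq_eq0.
Qed.

(** The variance identity. It bounds Fourier coefficients by the norm, gives the loss of norm on
    removing one frequency ([nsq_sub_coef]), and its equality case shows that an inner function with
    |g(0)| = 1 is constant. *)
Lemma nsqB_cmean f : L2 f -> nsq (fun t => f t - cmean f) = nsq f - csq (cmean f).
Proof.
move=> hf; set m := cmean f; have [i1 i2] := cint_L2 hf.
have e : (fun t => csq (f t - m)) = (fun t => csq (f t) +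
   (-2 * complex.Re m * complex.Re (f t) + (-2 * complex.Im m * complex.Im (f t)
   + csq m))).
  by apply/funext => t; rewrite /csq !reimE; ring.
rewrite /nsq e.
have j1 := igZ (-2 * complex.Re m) i1.
have j2 := igZ (-2 * complex.Im m) i2.
have j3 := igD j2 (ig_cst (csq m)).
rewrite (rmeanD (L2_ig hf) (igD j1 j3)) (rmeanD j1 j3) (rmeanD j2 (ig_cst _)).
rewrite (rmeanZ _ i1) (rmeanZ _ i2) rmean_cst /csq /=.
set u := rmean _; set x := rmean _; set y := rmean _.
by ring.
Qed.

Lemma csq_cmean_le f : L2 f -> csq (cmean f) <= nsq f.
Proof. by move=> hf; rewrite -subr_ge0 -nsqB_cmean // nsq_ge0. Qed.

Lemma nsq_expkM k f : nsq (fun t => f t * expk k t) = nsq f.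
Proof. by rewrite /nsq; under eq_fun do rewrite csqM csq_expk mulr1. Qed.

Lemma csq_fcoef_le f k : L2 f -> csq (fcoef f k) <= nsq f.
Proof.
move=> hf; rewrite fcoefE -(nsq_expkM (- k) f); apply: csq_cmean_le.
exact: L2_expkM.
Qed.

Lemma fcoefD f g k : L2 f -> L2 g ->
  fcoef (fun t => f t + g t) k = fcoef f k + fcoef g k.
Proof.
move=> hf hg; rewrite !fcoefE; under eq_fun do rewrite mulrDl.
by rewrite cmeanD //; apply: cint_L2; exact: L2_expkM.
Qed.

Lemma fcoefZ c f k : L2 f -> fcoef (fun t => c * f t) k = c * fcoef f k.
Proof.
move=> hf; rewrite !fcoefE; under eq_fun do rewrite -mulrA.
by rewrite cmeanZ //; apply: cint_L2; exact: L2_expkM.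
Qed.

Lemma fcoefB f g k : L2 f -> L2 g ->
  fcoef (fun t => f t - g t) k = fcoef f k - fcoef g k.
Proof.
move=> hf hg; rewrite !fcoefE; under eq_fun do rewrite mulrBl.
by rewrite cmeanB //; apply: cint_L2; exact: L2_expkM.
Qed.

Lemma fcoef_shift f k l : fcoef (fun t => f t * expk l t) k = fcoef f (k - l).
Proof.
rewrite !fcoefE; congr cmean; apply/funext => t.
by rewrite -mulrA -expkD opprB.
Qed.

Lemma fcoef_ae f g k : cmeasurable f -> cmeasurable g ->
  ae_circ (fun t => f t = g t) -> fcoef f k = fcoef g k.
Proof.
move=> mf mg h; rewrite !fcoefE; apply: cmean_ae.
- by apply: cmeasM => //; exact: cmeas_expk.
- by apply: cmeasM => //; exact: cmeas_expk.
- by apply: ae_circS h => t _ ->.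
Qed.

Lemma at0E f : L2 f -> at0 f = cmean f.
Proof.
move=> hf; rewrite /at0 fcoefE; congr cmean; apply/funext => t.
by rewrite oppr0 expk0 mulr1.
Qed.

Lemma H2D_ae f g : cmeasurable g -> H2D f -> ae_circ (fun t => f t = g t) -> H2D g.
Proof.
move=> mg [hf h0] h; split; first exact: L2_ae hf h.
move=> k k0; rewrite -(h0 _ k0); apply: fcoef_ae => //; first by case: hf.
by apply: ae_circS h => t _ ->.
Qed.

Lemma H2D_add f g : H2D f -> H2D g -> H2D (fun t => f t + g t).
Proof.
move=> [hf f0] [hg g0]; split; first exact: L2D.
by move=> k k0; rewrite fcoefD // f0 // g0 // addr0.
Qed.

Lemma H2DZ c f : H2D f -> H2D (fun t => c * f t).
Proof.
move=> [hf f0]; split; first exact: L2Z.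
by move=> k k0; rewrite fcoefZ // f0 // mulr0.
Qed.

Lemma H2D_shift f n : H2D f -> H2D (fun t => f t * expk n%:Z t).
Proof.
move=> [hf f0]; split; first exact: L2_expkM.
by move=> k k0; rewrite fcoef_shift f0 // (le_lt_trans _ k0) // gerBl.
Qed.

Lemma H2D_unshift f : H2D f -> at0 f = 0 -> H2D (fun t => f t * expk (-1) t).
Proof.
move=> [hf f0] h; split; first exact: L2_expkM.
move=> k k0; rewrite fcoef_shift opprK.
have [->//|k1] : k + 1 = 0 \/ k + 1 < 0 by lia.
exact: f0.
Qed.

End ComplexMeans.

(** * Uniqueness of Fourier coefficients *)


Section Multipliers.
Variable R : realType.
Local Notation C := (complex R).
Local Notation mu := (@lebesgue_measure R).
Local Notation D := (@circ R).
Implicit Types (f g h psi : R -> C).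

Lemma expk_2pi (k : int) : expk k (2 * pi : R) = 1.
Proof.
have e1 : expk 1 (2 * pi : R) = 1.
  by rewrite /expk mul1r; apply: cext; rewrite /= mulr_natl ?cos2pi ?sin2pi.
have en (n : nat) : expk n%:Z (2 * pi : R) = 1.
  by elim: n => [|n IH]; rewrite ?expk0 // -addn1 PoszD expkD IH e1 mulr1.
case: k => n //.
by rewrite NegzE -cconj_expk en cconj1.
Qed.

Lemma integral_FTC_periodic (F f : R -> R) :
  (forall x : R, is_derive x 1 F (f x)) -> continuous f ->
  F (2 * pi) = F 0 -> Rintegral mu D f = 0.
Proof.
move=> dF cf F0; rewrite /Rintegral /circ (@continuous_FTC2 _ f F).
- by rewrite F0 subee.
- exact: pi2_gt0.
- exact: continuous_subspaceT.
- have cF : continuous F.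
    move=> x; apply: differentiable_continuous; apply/derivable1_diffP.
    by have [] := dF x.
  split.
  + by move=> x _; have [] := dF x.
  + exact/cvg_at_right_filter/cF.
  + exact/cvg_at_left_filter/cF.
- by move=> x _; rewrite derive1E; have [_ ->] := dF x.
Qed.

Lemma cmean_expk (k : int) : k != 0 -> cmean (@expk R k) = 0.
Proof.
move=> k0; have kR : k%:~R != 0 :> R by rewrite intr_eq0.
have h := expk_2pi k.
have [hc hs] : cos (k%:~R * (2 * pi)) = 1 :> R /\ sin (k%:~R * (2 * pi)) = 0 :> R.
  by move: h; rewrite /expk /cexpi => -[-> ->].
apply: cext => /=; rewrite /rmean.
- rewrite (_ : Rintegral _ _ _ = 0) ?mulr0 //.
  apply: (@integral_FTC_periodic (fun t => k%:~R^-1 * sin (k%:~R * t))).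
  + move=> x; apply: is_derive_eq.
    by rewrite /GRing.scale /= !mulr1; field.
  + move=> x; apply: continuous_comp; last exact: continuous_cos.
    by apply: cvgM; [exact: cvg_cst|exact: cvg_id].
  + by rewrite hs !mulr0 sin0 mulr0.
- rewrite (_ : Rintegral _ _ _ = 0) ?mulr0 //.
  apply: (@integral_FTC_periodic (fun t => - k%:~R^-1 * cos (k%:~R * t))).
  + move=> x; apply: is_derive_eq.
    by rewrite /GRing.scale /= !mulr1; field.
  + move=> x; apply: continuous_comp; last exact: continuous_sin.
    by apply: cvgM; [exact: cvg_cst|exact: cvg_id].
  + by rewrite hc !mulr0 cos0.
Qed.

Lemma fcoef_expk (k l : int) : fcoef (@expk R k) l = (k == l)%:R.
Proof.
rewrite fcoefE (_ : (fun t => _) = expk (k - l)); last first.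
  by apply/funext => t; rewrite -expkD.
have [->|kl] := eqVneq k l; last by rewrite cmean_expk // subr_eq0.
rewrite subrr (_ : expk 0 = fun=> 1) ?cmean_cst //.
by apply/funext => t; rewrite expk0.
Qed.

Lemma H2D_expk (n : nat) : H2D (@expk R n%:Z).
Proof.
split; first exact: L2_expk.
by move=> k k0; rewrite fcoef_expk; case: eqP => // e; move: k0; rewrite -e.
Qed.

Lemma H2D_cst (c : C) : H2D (fun=> c).
Proof.
have := H2DZ c (H2D_expk 0).
by under eq_fun do rewrite expk0 mulr1.
Qed.

Lemma cintM_bounded h psi : cint h -> cmeasurable psi ->
  (forall t, csq (psi t) <= 1) -> cint (fun t => h t * psi t).
Proof.
move=> [h1 h2] mpsi b.
have mh : cmeasurable h by apply: cint_meas.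
have [m1 m2] := cmeasM mh mpsi.
have b1 t : `|complex.Re (psi t)| <= 1.
  rewrite -(@ler_pXn2r _ 2) ?nnegrE // ?expr1n ?real_normK ?num_real //.
  exact: le_trans (Re_sq_le_csq _) (b t).
have b2 t : `|complex.Im (psi t)| <= 1.
  rewrite -(@ler_pXn2r _ 2) ?nnegrE // ?expr1n ?real_normK ?num_real //.
  exact: le_trans (Im_sq_le_csq _) (b t).
have i1 : ig (fun t => `|complex.Re (h t)|) by exact: integrable_norm h1.
have i2 : ig (fun t => `|complex.Im (h t)|) by exact: integrable_norm h2.
have H x y u v : `|u| <= 1 -> `|v| <= 1 -> `|x| * `|u| + `|y| * `|v| <= `|x| + `|y| :> R.
  by move=> hu hv; apply: lerD; rewrite ler_piMr.
split; apply: (ig_le _ _ (igD i1 i2)) => // t _.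
  by rewrite cReM (le_trans (ler_normB _ _)) // !normrM H.
by rewrite cImM (le_trans (ler_normD _ _)) // !normrM H.
Qed.

Definition annih h := cint h /\ forall k, cmean (fun t => h t * expk k t) = 0.

(** Defined by the action on annihilated functions, so that closure under products is mere
    composition and a power such as [stepfun] never has to be expanded into exponentials. *)
Definition multiplier psi := forall h, annih h -> annih (fun t => h t * psi t).

Lemma multiplier_expk k : multiplier (@expk R k).
Proof.
move=> h [hi h0]; split.
  by apply: cintM_bounded => //; [exact: cmeas_expk|move=> t; rewrite csq_expk].
by move=> l; under eq_fun do rewrite -mulrA -expkD; rewrite h0.
Qed.

Lemma cint_expkM h k : cint h -> cint (fun t => h t * expk k t).
Proof.
move=> hi; apply: cintM_bounded => //; first exact: cmeas_expk.
by move=> t; rewrite csq_expk.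
Qed.

Lemma multiplierZ (c : C) psi : multiplier psi -> multiplier (fun t => c * psi t).
Proof.
move=> m h /m [hi h0]; split.
  by under eq_fun do rewrite mulrCA; apply: cintZ.
move=> l; under eq_fun do rewrite mulrCA -mulrA.
by rewrite cmeanZ ?h0 ?mulr0 //; apply: cint_expkM.
Qed.

Lemma multiplier_cst (c : C) : multiplier (fun=> c).
Proof.
have := multiplierZ c (@multiplier_expk 0).
by under eq_fun do rewrite expk0 mulr1.
Qed.

Lemma multiplierD psi1 psi2 : multiplier psi1 -> multiplier psi2 -> multiplier (fun t => psi1 t + psi2 t).
Proof.
move=> m1 m2 h ha; have [i1 z1] := m1 _ ha; have [i2 z2] := m2 _ ha; split.
  by under eq_fun do rewrite mulrDr; apply: cintD.
move=> l; under eq_fun do rewrite mulrDr mulrDl.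
by rewrite cmeanD ?z1 ?z2 ?addr0 //; apply: cint_expkM.
Qed.

Lemma multiplierM psi1 psi2 : multiplier psi1 -> multiplier psi2 -> multiplier (fun t => psi1 t * psi2 t).
Proof. by move=> m1 m2 h /m1 /m2; under eq_fun do rewrite -mulrA. Qed.

Lemma multiplierX psi n : multiplier psi -> multiplier (fun t => psi t ^+ n).
Proof.
move=> m; elim: n => [|n IH]; first exact: (multiplier_cst 1).
by under eq_fun do rewrite exprS; apply: multiplierM.
Qed.

(** The threshold 1/2 separates the two sides of the arc: the value is below 1/2 exactly where cos
    (t - x0) > c. Division by 4 keeps the values in [0, 1] when |c| <= 1. *)
Definition arcfun (c x0 t : R) : R := 2^-1 + (c - cos (t - x0)) / 4.

Lemma multiplier_arcfun c x0 : multiplier (fun t => Complex (arcfun c x0 t) 0).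
Proof.
(* [a] is -e^{-i x0}/8, so [a] e^{it} plus its conjugate is -cos (t - x0)/4. *)
pose a : C := Complex (- (8^-1 * cos x0)) (8^-1 * sin x0).
have := multiplierD (multiplier_cst (Complex (2^-1 + c / 4) 0))
  (multiplierD (multiplierZ a (@multiplier_expk 1)) (multiplierZ (cconj a) (@multiplier_expk (-1)))).
congr multiplier; apply/funext => t; apply: cext; rewrite !reimE /= /arcfun.
  by rewrite mul1r mulN1r cosN sinN cosB; field.
by rewrite mul1r mulN1r cosN sinN; ring.
Qed.

(** The polynomials of the elementary proof of the Stone-Weierstrass theorem. The exponent 2^n
    places the jump at y = 1/2: the limit is governed by whether (2y)^n tends to 0 or to
    infinity. *)
Definition stepfun (n : nat) (y : R) : R := (1 - y ^+ n) ^+ (2 ^ n).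

Lemma complexX (x : R) n : Complex (x ^+ n) 0 = Complex x 0 ^+ n.
Proof.
elim: n => [|n IH]; first by rewrite !expr0.
by rewrite !exprS -IH; apply: cext; rewrite !reimE /=; ring.
Qed.

Lemma multiplier_stepfun c x0 n : multiplier (fun t => Complex (stepfun n (arcfun c x0 t)) 0).
Proof.
have m1 := multiplierX n (@multiplier_arcfun c x0).
have := multiplierX (2 ^ n) (multiplierD (multiplier_cst 1) (multiplierZ (-1) m1)).
congr multiplier; apply/funext => t; rewrite /stepfun mulN1r complexX; congr (_ ^+ _).
by rewrite -complexX; apply: cext; rewrite !reimE //= subr0.
Qed.

Lemma bernoulli_ge (x : R) n : 0 <= x <= 1 -> 1 - n%:R * x <= (1 - x) ^+ n.
Proof.
move=> /andP[x0 x1]; elim: n => [|n IH]; first by rewrite mul0r subr0 expr0.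
have h : 0 <= 1 - x by rewrite subr_ge0.
have := ler_wpM2l h IH; rewrite -exprS; apply: le_trans.
rewrite -natr1; have n0 : 0 <= n%:R :> R by [].
have := mulr_ge0 n0 (sqr_ge0 x); rewrite expr2; lra.
Qed.

Lemma stepfun_bound n y : 0 <= y <= 1 -> 0 <= stepfun n y <= 1.
Proof.
move=> /andP[y0 y1]; rewrite /stepfun.
have h1 : y ^+ n <= 1 by rewrite exprn_ile1.
have h0 : 0 <= y ^+ n by rewrite exprn_ge0.
by rewrite exprn_ge0 ?exprn_ile1 ?subr_ge0 // gerBl.
Qed.

Lemma stepfun_cvg1 y : 0 <= y -> y < 2^-1 -> stepfun n y @[n --> \oo] --> (1 : R).
Proof.
move=> y0 y1; have y01 : 0 <= y <= 1 by rewrite y0 /=; lra.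
apply: (@squeeze_cvgr _ _ _ R (fun n => 1 - (2 * y) ^+ n) (fun=> 1)).
- apply: nearW => n; have /andP[_ ->] := stepfun_bound n y01; rewrite andbT.
  rewrite exprMn -natrX; apply: bernoulli_ge.
  by rewrite exprn_ge0 //= exprn_ile1 //; case/andP: y01.
- rewrite -[X in _ --> X]subr0; apply: cvgB; first exact: cvg_cst.
  by apply: cvg_expr; rewrite ger0_norm; lra.
- exact: cvg_cst.
Qed.

(** With x = y^n and N = 2^n, Bernoulli's inequality gives N x <= (1 + x)^N, hence N x (1 - x)^N <=
    (1 - x^2)^N <= 1. As N x = (2y)^n, the function is at most (2y)^(-n). *)
Lemma stepfun_cvg0 y : 2^-1 < y -> y <= 1 -> stepfun n y @[n --> \oo] --> (0 : R).
Proof.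
move=> y0 y1; have y01 : 0 <= y <= 1 by rewrite y1 andbT; lra.
have y20 : 0 < 2 * y by lra.
apply: (@squeeze_cvgr _ _ _ R (fun=> 0) (fun n => ((2 * y)^-1) ^+ n)).
- apply: nearW => n; have /andP[-> _] := stepfun_bound n y01 => /=.
  rewrite exprVn -[X in _ <= X]mul1r ler_pdivlMr ?exprn_gt0 // exprMn -natrX.
  have yn : 0 <= y ^+ n <= 1.
    by case/andP: y01 => h1 h2; rewrite exprn_ge0 // exprn_ile1.
  have /andP[h _] := stepfun_bound n y01.
  move: yn; rewrite /stepfun; move: h; rewrite /stepfun.
  set x := y ^+ n; set N := (2 ^ n)%N => h yn.
  have hb : N%:R * x <= (1 + x) ^+ N.
    have : (1 + x) ^+ N >= 1 + N%:R * x.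
      case/andP: yn => x0 x1; elim: N {h} => [|m IH]; first by rewrite mul0r addr0 expr0.
      have h : 0 <= 1 + x by lra.
      have := ler_wpM2l h IH; rewrite -exprS; apply: le_trans.
      rewrite -natr1; have m0 : 0 <= m%:R :> R by [].
      have := mulr_ge0 m0 (sqr_ge0 x); rewrite expr2; lra.
    by apply: le_trans; lra.
  apply: le_trans (ler_wpM2l h hb) _; rewrite -exprMn.
  have -> : (1 - x) * (1 + x) = 1 - x ^+ 2 by ring.
  case/andP: yn => x0 x1; have x2 : 0 <= x ^+ 2 <= 1.
    by rewrite sqr_ge0 exprn_ile1.
  by case/andP: x2 => z0 z1; rewrite exprn_ile1 ?subr_ge0 // gerBl.
- exact: cvg_cst.
- by apply: cvg_expr; rewrite ger0_norm ?invr_ge0 ?invf_lt1; lra.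
Qed.

End Multipliers.


(** * Indicators of arcs as bounded limits of multipliers *)

Section Arcs.
Variable R : realType.
Local Notation C := (complex R).
Local Notation mu := (@lebesgue_measure R).
Local Notation D := (@circ R).

Lemma rmeasM (f g : R -> R) : rmeas f -> rmeas g -> rmeas (fun t => f t * g t).
Proof. by move=> /rmeasP mf /rmeasP mg; apply/rmeasP; exact: measurable_funM. Qed.

Lemma rmean_dct (u : nat -> R -> R) (w v : R -> R) :
  (forall n, rmeas (u n)) -> rmeas w ->
  ae_circ (fun t => u n t @[n --> \oo] --> w t) ->
  ae_circ (fun t => forall n, `|u n t| <= v t) -> ig v ->
  rmean (u n) @[n --> \oo] --> rmean w.
Proof.
move=> mu_ mw uw uv iv.
have mD := @mcirc R.
have m1 n : @measurable_fun _ _ (measurableTypeR R) _ D (EFin \o u n).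
  by apply/measurable_EFinP; exact: mu_.
have m2 : @measurable_fun _ _ (measurableTypeR R) _ D (EFin \o w).
  exact/measurable_EFinP.
have c1 : {ae mu, forall x, D x -> (fun n => (EFin \o u n) x) @ \oo --> (EFin \o w) x}.
  by apply: ae_circS uw => t _ h; apply: cvg_EFin => //; exact: nearW.
have c2 : {ae mu, forall x n, D x -> (`|(EFin \o u n) x| <= (EFin \o v) x)%E}.
  move: uv; apply: (@filterS _ _ (ae_filter_ringOfSetsType mu)) => t h n Dt.
  by rewrite /= lee_fin; exact: h.
have [iw _ h] := dominated_convergence mD m1 m2 c1 iv c2.
rewrite /rmean; apply: cvgM; first exact: cvg_cst.
apply: fine_cvg; rewrite fineK; first exact: h.
exact: integrable_fin_num iw.
Qed.

Lemma ae_circ_neq (a : R) : ae_circ (fun t => t != a).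
Proof.
exists [set a]; split; first exact: measurable_set1.
  exact: lebesgue_measure_set1.
by move=> t /= /not_implyP[_ /negP/negPn/eqP].
Qed.

Lemma arcfun01 (c x0 t : R) : -1 <= c <= 1 -> 0 <= arcfun c x0 t <= 1.
Proof.
move=> /andP[c1 c2]; rewrite /arcfun.
have := cos_geN1 (t - x0); have := cos_le1 (t - x0) => h1 h2.
by apply/andP; split; lra.
Qed.

(** The arc from 0 to x has centre x/2 and half-width x/2. For t and x strictly between 0 and 2 pi
    the right-hand side has the sign of x - t, because sin (t/2) > 0. *)
Lemma cosB_half (t x : R) :
  cos (t - x / 2) - cos (x / 2) = 2 * sin (t / 2) * sin ((x - t) / 2).
Proof.
have -> : t - x / 2 = t / 2 - (x - t) / 2 by field.
have -> : x / 2 = t / 2 + (x - t) / 2 by field.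
by rewrite cosB cosD; ring.
Qed.

Lemma arc_step_cvg (t x : R) : 0 < t < 2 * pi -> 0 < x < 2 * pi -> t != x ->
  stepfun n (arcfun (cos (x / 2)) (x / 2) t) @[n --> \oo] -->
  ((t <= x)%R%:R : R).
Proof.
move=> /andP[t0 t1] /andP[x0 x1] tx.
have st : 0 < sin (t / 2) by rewrite sin_gt0_pi //; apply/andP; split; lra.
have /andP[a0 a1] : 0 <= arcfun (cos (x / 2)) (x / 2) t <= 1.
  by apply: arcfun01; rewrite cos_geN1 cos_le1.
have e := cosB_half t x; move: tx; rewrite neq_lt => /orP[] tx.
- rewrite (ltW tx); apply: stepfun_cvg1 => //; rewrite /arcfun.
  have h : 0 < sin ((x - t) / 2) by rewrite sin_gt0_pi //; apply/andP; split; lra.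
  by have := mulr_gt0 st h; lra.
- rewrite leNgt tx; apply: stepfun_cvg0 => //; rewrite /arcfun.
  have h : 0 < sin ((t - x) / 2) by rewrite sin_gt0_pi //; apply/andP; split; lra.
  have eN : (x - t) / 2 = - ((t - x) / 2) by field.
  by have := mulr_gt0 st h; move: e; rewrite eN sinN; lra.
Qed.

Lemma circ_in (t : R) : D t -> t != 0 -> t != 2 * pi -> 0 < t < 2 * pi.
Proof.
rewrite /circ /= in_itv /= => /andP[h1 h2] h3 h4.
by rewrite !lt_neqAle h1 h2 h4 eq_sym h3.
Qed.

(** Dominated convergence along [stepfun], with |f| as dominating function. The points 0, x and 2
    pi, where the limit may fail, form a null set. Real multipliers suffice, since f will be a real
    or imaginary part. *)
Lemma annih_step (f : R -> R) :
  (forall g : R -> R, multiplier (fun t => Complex (g t) 0) -> rmean (fun t => f t * g t) = 0) ->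
  ig f -> forall x, 0 < x < 2 * pi -> rmean (fun t => f t * (t <= x)%R%:R) = 0.
Proof.
move=> h0 hf x hx.
have mf := ig_meas hf.
pose g n t := stepfun n (arcfun (cos (x / 2)) (x / 2) t).
have mg n : rmeas (g n).
  apply/rmeasP; apply: measurable_funX; apply: measurable_funB => //.
  apply: measurable_funX; rewrite /arcfun; apply: measurable_funD => //.
  apply: measurable_funM => //; apply: measurable_funB => //.
  apply: measurable_funTS; apply: (@measurableT_comp _ _ _ _ _ _ (@cos R)).
    by apply: continuous_measurable_fun; exact: continuous_cos.
  exact: measurable_funB.
have ms : rmeas (fun t : R => (t <= x)%R%:R : R).
  apply/rmeasP; rewrite (_ : (fun t => _) = \1_(`]-oo, x]%classic : set R)).
    exact: measurable_indic.
  by apply/funext => t; rewrite indicE mem_setE in_itv.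
have cv : rmean (fun t => f t * g n t) @[n --> \oo] -->
    rmean (fun t => f t * (t <= x)%R%:R).
  apply: (@rmean_dct (fun n t => f t * g n t) _ (fun t => `|f t|)).
  - by move=> n; exact: rmeasM.
  - exact: rmeasM.
  - have a1 : ae_circ (fun t : R => 0 < t < 2 * pi).
      by apply: (ae_circS2 _ (ae_circ_neq 0) (ae_circ_neq (2 * pi))); exact: circ_in.
    apply: (ae_circS2 _ a1 (ae_circ_neq x)) => t Dt ht tx.
    by apply: cvgM; [exact: cvg_cst|exact: arc_step_cvg].
  - apply: ae_circW => t n; rewrite normrM ler_piMr //.
    have /andP[h1 h2] : 0 <= g n t <= 1.
      by apply: stepfun_bound; apply: arcfun01; rewrite cos_geN1 cos_le1.
    by rewrite ger0_norm.
  - exact: integrable_norm.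
have e : (fun n => rmean (fun t => f t * g n t)) = (fun=> 0).
  by apply/funext => n; apply: h0; exact: multiplier_stepfun.
move: cv; rewrite e => cv; apply: esym; apply: (cvg_unique _ _ cv); last exact: cvg_cst.
exact: Rhausdorff.
Qed.

End Arcs.


(** * Vanishing almost everywhere *)

Section Uniqueness.
Variable R : realType.
Local Notation C := (complex R).
Local Notation mu := (@lebesgue_measure R).
Local Notation D := (@circ R).

(** The primitive of f, extended by 0 outside the circle, vanishes identically, and by Lebesgue
    differentiation its derivative is f almost everywhere. The hypothesis on the full mean covers
    the primitive from 2 pi on. *)
Lemma zero_prefix_ae (f : R -> R) : ig f -> rmean f = 0 ->
  (forall x, 0 < x < 2 * pi -> rmean (fun t => f t * (t <= x)%R%:R) = 0) ->
  ae_circ (fun t => f t = 0).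
Proof.
move=> hf f0 hx.
have iT : mu.-integrable setT (EFin \o (f \_ D)).
  rewrite -restrict_EFin; have [h _] := integrable_mkcond (mu := mu) (EFin \o f) (@mcirc R).
  exact: h.
have iy (y : R) : mu.-integrable [set` Interval (BLeft 0) (BRight y)]
    (EFin \o (f \_ D)).
  apply: (@integrableS _ _ _ mu setT) => //; exact: measurable_itv.
have loc : locally_integrable [set: R] (f \_ D).
  by apply: integrable_locally => //; exact: mcirc.
have pi0 : (2 * pi : R)^-1 != 0 by rewrite invr_eq0 lt0r_neq0 // pi2_gt0.
have F0 (y : R) : Rintegral mu [set` Interval (BLeft 0) (BRight y)] (f \_ D) = 0.
  have -> : Rintegral mu [set` Interval (BLeft 0) (BRight y)] (f \_ D) =
      Rintegral mu D (fun t => f t * (t <= y)%R%:R).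
    rewrite -(@Rintegral_mkcondr _ _ _ mu) setIC Rintegral_mkcondr.
    apply: eq_Rintegral => t /set_mem Dt; rewrite patchE.
    have := Dt; rewrite /circ /= in_itv /= => /andP[t0 _].
    case: ifPn => [/set_mem|/negP]; rewrite ?inE /= in_itv /= t0 /=.
      by move=> ->; rewrite mulr1.
    by move/negP/negbTE => ->; rewrite mulr0.
  suff /eqP : rmean (fun t => f t * (t <= y)%R%:R) = 0.
    by rewrite mulf_eq0 (negbTE pi0) /= => /eqP.
  have mle : rmeas (fun t : R => f t * (t <= y)%R%:R).
    apply: rmeasM; first exact: ig_meas.
    apply/rmeasP; rewrite (_ : (fun t => _) = \1_(`]-oo, y]%classic : set R)).
      exact: measurable_indic.
    by apply/funext => t; rewrite indicE mem_setE in_itv.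
  have [y0|y0] := leP y 0.
    rewrite (@rmean_ae _ _ (fun=> 0)) ?rmean_cst //; first exact: measurable_cst.
    apply: ae_circS (ae_circ_neq 0) => t; rewrite /circ /= in_itv /= => /andP[h1 _] h2.
    rewrite leNgt (le_lt_trans y0) ?mulr0 //.
    by rewrite lt_neqAle h1 eq_sym h2.
  have [y1|y1] := ltP y (2 * pi); first by rewrite hx // y0 y1.
  rewrite -[RHS]f0 (@rmean_ae _ _ f) //; first exact: ig_meas.
  apply: (ae_circS _ (ae_circ_neq 0)) => t; rewrite /circ /= in_itv /= => /andP[_ h1] _.
  by rewrite (le_trans h1 y1) mulr1.
have := FTC1 iy loc.
rewrite (_ : (fun x : R => _) = fun=> 0); last exact/funext.
move=> h; have h1 : ae_circ (fun x => 0 < x -> f x = 0).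
  move: h; apply: (@filterS _ _ (ae_filter_ringOfSetsType mu)) => x h Dx x0.
  have [|_] := h; first by rewrite ?bnd_simp /= ?lte_fin ?(ltW x0) // /Order.lt /= ltW.
  by rewrite derive1_cst patchE mem_set.
apply: (ae_circS2 _ h1 (ae_circ_neq 0)) => t Dt h2 t0.
apply: h2; have := Dt; rewrite /circ /= in_itv /= => /andP[h2 _].
by rewrite lt_neqAle h2 eq_sym t0.
Qed.

Lemma annih_ae0 (h : R -> C) : annih h -> ae_circ (fun t => h t = 0).
Proof.
move=> ha; have [hi h0] := ha; have [i1 i2] := hi.
have c0 (g : R -> R) : multiplier (fun t => Complex (g t) 0) ->
    rmean (fun t => complex.Re (h t) * g t) = 0 /\
    rmean (fun t => complex.Im (h t) * g t) = 0.
  move=> /(_ _ ha)[_ /(_ 0)]; rewrite /cmean => -[].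
  have e (t : R) : h t * Complex (g t) 0 * expk 0 t =
    Complex (complex.Re (h t) * g t) (complex.Im (h t) * g t).
    by rewrite expk0 mulr1; apply: cext; rewrite !reimE /=; ring.
  by under eq_fun do rewrite e; move=> ->; under eq_fun do rewrite e; move=> ->.
have m1 : multiplier (fun t => Complex ((fun=> 1) t) 0 : C) by exact: multiplier_cst.
have [r1 r2] := c0 _ m1.
have z1 : ae_circ (fun t => complex.Re (h t) = 0).
  apply: zero_prefix_ae => //.
    by rewrite -[RHS]r1; congr rmean; apply/funext => t; rewrite mulr1.
  by apply: annih_step => // g /c0[].
have z2 : ae_circ (fun t => complex.Im (h t) = 0).
  apply: zero_prefix_ae => //.
    by rewrite -[RHS]r2; congr rmean; apply/funext => t; rewrite mulr1.
  by apply: annih_step => // g /c0[].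
by apply: (ae_circS2 _ z1 z2) => t _ h1 h2; apply: cext.
Qed.

Lemma fcoef_inj0 (f : R -> C) : L2 f -> (forall k, fcoef f k = 0) ->
  ae_circ (fun t => f t = 0).
Proof.
move=> hf h; apply: annih_ae0; split; first exact: cint_L2.
by move=> k; have := h (- k); rewrite fcoefE opprK.
Qed.

End Uniqueness.

(** * Completeness and Taylor approximation *)


Section Completeness.
Variable R : realType.
Local Notation C := (complex R).
Local Notation mu := (@lebesgue_measure R).
Local Notation D := (@circ R).

Lemma integral_rmean (f : R -> R) : ig f ->
  (\int[mu]_(t in D) (f t)%:E = (2 * pi * rmean f)%:E)%E.
Proof.
move=> hf; rewrite /rmean mulrA mulfV ?lt0r_neq0 ?pi2_gt0 // mul1r fineK //.
exact: (integrable_fin_num (@mcirc R) hf).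
Qed.

(** The sum, taken in the extended reals, has integral at most 2 pi B by monotone convergence, so it
    is finite almost everywhere and bounds the partial sums there. *)
Lemma cvg_series_ae (d : nat -> R -> R) (B : R) :
  (forall n, ig (d n)) -> (forall n t, 0 <= d n t) ->
  (forall n, \sum_(0 <= k < n) rmean (d k) <= B) ->
  ae_circ (fun t => cvgn (series (fun n => d n t))).
Proof.
move=> hd d0 hB.
have md n : @measurable_fun _ _ (measurableTypeR R) _ D (EFin \o d n).
  by apply/measurable_EFinP; apply: ig_meas.
have ed0 n t : D t -> (0 <= (d n t)%:E)%E by move=> _; rewrite lee_fin.
pose S t := (\sum_(0 <= n <oo) (d n t)%:E)%E.
have S0 t : (0 <= S t)%E by apply: nneseries_ge0 => n _ _; rewrite lee_fin.
have mS : @measurable_fun _ _ (measurableTypeR R) _ D S.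
  apply: (@ge0_emeasurable_sum _ _ _ D (fun n t => (d n t)%:E) predT).
    by move=> k t Dt _; exact: ed0.
  by move=> k _; exact: md.
have iS : mu.-integrable D S.
  apply/integrableP; split; first exact: mS.
  apply: (@le_lt_trans _ _ (\int[mu]_(t in D) S t)%E).
    rewrite le_eqVlt; apply/orP; left; apply/eqP.
    by apply: eq_integral => t _; rewrite gee0_abs.
  rewrite (integral_nneseries mu (@mcirc R) md ed0).
  apply: le_lt_trans (ltry (2 * pi * B)); apply: lime_le.
    by apply: is_cvg_nneseries => n _ _; apply: integral_ge0 => t; exact: ed0.
  apply: nearW => n; under eq_bigr do rewrite integral_rmean //.
  by rewrite sumEFin lee_fin -mulr_sumr ler_pM2l ?pi2_gt0.
have := integrable_ae (@mcirc R) iS.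
apply: (@filterS _ _ (ae_filter_ringOfSetsType mu)) => t h Dt.
apply: nondecreasing_is_cvgn.
  by apply: nondecreasing_series => n _ _; exact: d0.
exists (fine (S t)) => _ [n _ <-].
rewrite -lee_fin fineK; last exact: h.
rewrite /series /= -sumEFin; apply: nneseries_lim_ge => k _ _.
by rewrite lee_fin.
Qed.

(** The upper limit is measurable whether or not the sequence converges. Where it is infinite,
    [fine] supplies the default value 0. *)
Lemma measurable_limit (u : nat -> R -> R) : (forall n, rmeas (u n)) ->
  exists2 w : R -> R, rmeas w &
    forall t, cvgn (fun n => u n t) -> u n t @[n --> \oo] --> w t.
Proof.
move=> mu_; exists (fun t => fine (limn_esup (fun n => (u n t)%:E))).
  have m1 : @measurable_fun _ _ (measurableTypeR R) _ D
      (fun t => limn_esup (fun n => (u n t)%:E)).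
    by apply: measurable_fun_limn_esup => n; apply/measurable_EFinP; exact: mu_.
  have mf : measurable_fun setT (@fine R) by exact: measurable_realfun.fine_measurable.
  exact: (measurableT_comp mf m1).
move=> t; set l := limn _ => h.
have hE : (u n t)%:E @[n --> \oo] --> l%:E by apply: cvg_EFin => //; exact: nearW.
by rewrite (cvg_limn_einf_sup hE).
Qed.

Lemma rmean_fatou (u : nat -> R -> R) (w : R -> R) (B : R) :
  (forall n, ig (u n)) -> (forall n t, 0 <= u n t) ->
  rmeas w -> (forall t, 0 <= w t) ->
  ae_circ (fun t => u n t @[n --> \oo] --> w t) ->
  (forall n, rmean (u n) <= B) -> ig w /\ rmean w <= B.
Proof.
move=> hu u0 mw w0 uw hB.
have mD := @mcirc R.
have m1 n : @measurable_fun _ _ (measurableTypeR R) _ D (EFin \o u n).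
  by apply/measurable_EFinP; apply: ig_meas.
have m2 : @measurable_fun _ _ (measurableTypeR R) _ D (EFin \o w).
  exact/measurable_EFinP.
have m3 : @measurable_fun _ _ (measurableTypeR R) _ D
    (fun t => limn_einf (fun n => (EFin \o u n) t)).
  have -> : (fun t => limn_einf (fun n => (EFin \o u n) t)) =
      (fun t => - limn_esup (fun n => - (EFin \o u n) t))%E.
    by apply/funext => t; rewrite -limn_einfN; congr limn_einf;
      apply/funext => n /=; rewrite ?oppeK ?opprK.
  apply: measurableT_comp => //; apply: measurable_fun_limn_esup => n.
  by apply: measurableT_comp => //; exact: m1.
have e0 n t : D t -> (0 <= (EFin \o u n) t)%E by move=> _; rewrite lee_fin.
have e : (\int[mu]_(t in D) (w t)%:E =
    \int[mu]_(t in D) limn_einf (fun n => (EFin \o u n) t))%E.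
  apply: (ae_eq_integral _ _ mD m2 m3).
  apply: ae_circS uw => t _ h.
  have hE : (EFin \o u n) t @[n --> \oo] --> (w t)%:E.
    by apply: cvg_EFin => //; exact: nearW.
  by rewrite (cvg_limn_einf_sup hE).
have le : (\int[mu]_(t in D) (w t)%:E <= (2 * pi * B)%:E)%E.
  rewrite e; apply: le_trans (fatou mu mD m1 e0) _.
  rewrite limn_einf_lim; apply: lime_le; first exact: is_cvg_einfs.
  apply: nearW => n; apply: (@le_trans _ _ (\int[mu]_(t in D) (EFin \o u n) t)%E).
    by apply: ereal_inf_lbound; exists n => //=.
  by rewrite integral_rmean // lee_fin ler_pM2l ?pi2_gt0.
have iw : ig w.
  apply/integrableP; split => //; apply: le_lt_trans (ltry (2 * pi * B)).
  apply: le_trans le; rewrite le_eqVlt; apply/orP; left; apply/eqP.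
  by apply: eq_integral => t _; rewrite /= ger0_norm.
by split => //; move: le; rewrite integral_rmean // lee_fin ler_pM2l ?pi2_gt0.
Qed.

(** The Riesz-Fischer theorem. A subsequence whose increments have mean square at most 4^-k
    converges almost everywhere; Fatou's lemma then transfers the Cauchy bound of the whole sequence
    to the distance from the limit. *)
Lemma complete_real (u : nat -> R -> R) :
  (forall n, rmeas (u n)) -> (forall m n, ig (fun t => (u m t - u n t) ^+ 2)) ->
  (forall e, 0 < e -> exists N, forall m n, (N <= m)%N -> (N <= n)%N ->
     rmean (fun t => (u m t - u n t) ^+ 2) <= e) ->
  exists2 w, rmeas w & forall e, 0 < e -> exists N, forall n, (N <= n)%N ->
     ig (fun t => (u n t - w t) ^+ 2) /\ rmean (fun t => (u n t - w t) ^+ 2) <= e.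
Proof.
move=> mu_ hu hC.
have e4 k : (0 : R) < (4^-1) ^+ k by rewrite exprn_gt0 // invr_gt0.
have /choice[N0 hN0] : forall k, exists N, forall m n, (N <= m)%N -> (N <= n)%N ->
     rmean (fun t => (u m t - u n t) ^+ 2) <= 4^-1 ^+ k by move=> k; exact: hC.
(* Summing the successors of all earlier thresholds yields an index that grows with k and exceeds
   both [N0 k] and k. *)
pose phi k := (\sum_(i < k.+1) (N0 i).+1)%N.
have phi_ge k : (N0 k <= phi k)%N by rewrite /phi big_ord_recr /= addnS ltnW // ltnS leq_addl.
have phi_S k : (phi k <= phi k.+1)%N by rewrite /phi [leqRHS]big_ord_recr /= leq_addr.
have phi_mono k l : (k <= l)%N -> (phi k <= phi l)%N.
  by move=> kl; apply: (homo_leq leqnn leq_trans phi_S).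
have phi_id k : (k <= phi k)%N.
  by elim: k => // k IH; rewrite /phi big_ord_recr /= addnS ltnS (leq_trans IH) ?leq_addr.
pose v k := u (phi k).
pose d k t := `|v k.+1 t - v k t|.
have md k : rmeas (d k).
  apply/rmeasP; apply: measurableT_comp => //.
  by apply: measurable_funB; exact: mu_.
have d2 k : rmean (fun t => d k t ^+ 2) <= 4^-1 ^+ k.
  rewrite /d; under eq_fun do rewrite real_normK ?num_real //.
  by apply: hN0; rewrite (leq_trans (phi_ge _)) // phi_S.
have id2 k : ig (fun t => d k t ^+ 2).
  by rewrite /d; under eq_fun do rewrite real_normK ?num_real //; exact: hu.
(* AM-GM: [2 d <= 2^k d^2 + 2^-k] *)
have dle k t : d k t <= 2^-1 * (2 ^+ k * d k t ^+ 2 + 2^-1 ^+ k).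
  have h2 : (2 : R) ^+ k != 0 by rewrite expf_neq0.
  have p2 : 0 < (2 : R) ^+ k by rewrite exprn_gt0.
  rewrite exprVn -subr_ge0.
  have -> : 2^-1 * (2 ^+ k * d k t ^+ 2 + (2 ^+ k)^-1) - d k t =
      2^-1 * (2 ^+ k)^-1 * (2 ^+ k * d k t - 1) ^+ 2 by field.
  by rewrite mulr_ge0 ?sqr_ge0 // mulr_ge0 ?invr_ge0 // ltW.
have ig0 k : ig (fun t => 2^-1 * (2 ^+ k * d k t ^+ 2 + 2^-1 ^+ k)).
  by apply: igZ; apply: igD; [apply: igZ|exact: ig_cst].
have id k : ig (d k).
  apply: (ig_le (md k) _ (ig0 k)) => t _.
  by rewrite ger0_norm ?normr_ge0 //; exact: dle.
have rd k : rmean (d k) <= 2^-1 ^+ k.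
  apply: le_trans (rmean_le (id k) (ig0 k) (fun t _ => dle k t)) _.
  rewrite rmeanZ; last by apply: igD; [apply: igZ|exact: ig_cst].
  rewrite rmeanD; [|by apply: igZ|exact: ig_cst].
  rewrite rmeanZ // rmean_cst.
  have h := ler_wpM2l (exprn_ge0 k (ler0n R 2)) (d2 k).
  have e : 2 ^+ k * 4^-1 ^+ k = 2^-1 ^+ k :> R.
    by rewrite -exprMn; congr (_ ^+ _); field.
  by rewrite e in h; lra.
have sumle n : \sum_(0 <= k < n) rmean (d k) <= 2.
  apply: (@le_trans _ _ (\sum_(0 <= k < n) 2^-1 ^+ k)); first exact: ler_sum.
  have -> : \sum_(0 <= k < n) 2^-1 ^+ k = 2 - 2 * 2^-1 ^+ n :> R.
    elim: n => [|n IH]; first by rewrite big_nil expr0; ring.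
    by rewrite big_nat_recr //= IH exprS; field.
  by rewrite gerBl mulr_ge0 // exprn_ge0.
have cd := cvg_series_ae id (fun n t => normr_ge0 _) sumle.
have [w mw hw] := measurable_limit (fun k => mu_ (phi k)).
have cv : ae_circ (fun t => v n t @[n --> \oo] --> w t).
  apply: ae_circS cd => t _ h; apply: hw.
  (* The subsequence is its first term plus a telescoping series, which converges absolutely at
     t. *)
  have h1 : cvgn (series (telescope (fun n => v n t))) by exact: normed_cvg.
  rewrite (_ : (fun n => u (phi n) t) =
    (fun n => v 0%N t + series (telescope (fun n => v n t)) n)).
    by apply: is_cvgD => //; exact: is_cvg_cst.
  by apply/funext => n; rewrite -(eq_sum_telescope (fun n => v n t)).
exists w => // e e0; have [N hN] := hC _ e0; exists N => n Nn.
(* The shift by N puts every index of the subsequence beyond N, so the Cauchy bound holds for all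
   k. *)
apply: (@rmean_fatou (fun k t => (u n t - v (k + N)%N t) ^+ 2)).
- by move=> k; exact: hu.
- by move=> k t; exact: sqr_ge0.
- by apply/rmeasP; apply: measurable_funX; apply: measurable_funB => //; exact: mu_.
- by move=> t; exact: sqr_ge0.
- apply: ae_circS cv => t _ h.
  under eq_fun do rewrite expr2; rewrite expr2.
  have h' : u n t - v (k + N)%N t @[k --> \oo] --> u n t - w t.
    apply: cvgB; first exact: cvg_cst.
    by rewrite (cvg_shiftn N (fun k => v k t)).
  exact: cvgM.
- by move=> k; apply: hN => //; rewrite (leq_trans (leq_addl k N)).
Qed.

End Completeness.


(** * Taylor polynomials in the Hardy space *)

Section Hardy.
Variable R : realType.
Local Notation C := (complex R).
Local Notation mu := (@lebesgue_measure R).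
Local Notation D := (@circ R).
Implicit Types (f g h : R -> C) (c : nat -> C).

(** Identities that pass to an L^2 limit are proved through this squeeze: the squared modulus of the
    difference of the two sides is bounded by a null sequence. *)
Lemma csq_lim0 (z : C) (u : nat -> R) : (\forall n \near \oo, csq z <= u n) ->
  u n @[n --> \oo] --> (0 : R) -> z = 0.
Proof.
move=> hz hu; apply: csq_eq0; apply/eqP; rewrite eq_le csq_ge0 andbT.
have e := cvg_lim (@Rhausdorff R) hu; rewrite -e; apply: limr_ge => //.
by apply/cvg_ex; exists 0.
Qed.

Lemma L2_complete (f : nat -> R -> C) : (forall n, L2 (f n)) ->
  (forall e, 0 < e -> exists N, forall m n, (N <= m)%N -> (N <= n)%N ->
     nsq (fun t => f m t - f n t) <= e) ->
  exists2 g, L2 g & nsq (fun t => f n t - g t) @[n --> \oo] --> (0 : R).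
Proof.
move=> hf hC.
have ic m n := L2_ig (L2B (hf m) (hf n)).
have mfmn m n := L2_meas (L2B (hf m) (hf n)).
have ire m n : ig (fun t => (complex.Re (f m t) - complex.Re (f n t)) ^+ 2).
  apply: (ig_le _ _ (ic m n)).
    apply/rmeasP; apply: measurable_funX.
    by apply: measurable_funB; [have [[]] := hf m|have [[]] := hf n].
  move=> t _; rewrite ger0_norm ?sqr_ge0 //.
  by have := Re_sq_le_csq (f m t - f n t); rewrite !reimE.
have iim m n : ig (fun t => (complex.Im (f m t) - complex.Im (f n t)) ^+ 2).
  apply: (ig_le _ _ (ic m n)).
    apply/rmeasP; apply: measurable_funX.
    by apply: measurable_funB; [have [[]] := hf m|have [[]] := hf n].
  move=> t _; rewrite ger0_norm ?sqr_ge0 //.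
  by have := Im_sq_le_csq (f m t - f n t); rewrite !reimE.
have [|||w1 mw1 hw1] := @complete_real R (fun n t => complex.Re (f n t)).
- by move=> n; have [[]] := hf n.
- exact: ire.
- move=> e /hC [N hN]; exists N => m n Nm Nn; apply: le_trans (hN _ _ Nm Nn).
  apply: rmean_le => // t _.
  by have := Re_sq_le_csq (f m t - f n t); rewrite !reimE.
have [|||w2 mw2 hw2] := @complete_real R (fun n t => complex.Im (f n t)).
- by move=> n; have [[]] := hf n.
- exact: iim.
- move=> e /hC [N hN]; exists N => m n Nm Nn; apply: le_trans (hN _ _ Nm Nn).
  apply: rmean_le => // t _.
  by have := Im_sq_le_csq (f m t - f n t); rewrite !reimE.
pose g t := Complex (w1 t) (w2 t).
have mg : cmeasurable g by split.
have eg n t : csq (f n t - g t) =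
  (complex.Re (f n t) - w1 t) ^+ 2 + (complex.Im (f n t) - w2 t) ^+ 2.
  by rewrite /csq !reimE.
have H e : 0 < e -> exists N, forall n, (N <= n)%N ->
    ig (fun t => csq (f n t - g t)) /\ nsq (fun t => f n t - g t) <= e.
  move=> e0; have e2 : 0 < e / 2 by rewrite divr_gt0.
  have [N1 h1] := hw1 _ e2; have [N2 h2] := hw2 _ e2.
  exists (maxn N1 N2) => n; rewrite geq_max => /andP[/h1[i1 r1] /h2[i2 r2]].
  rewrite /nsq; under eq_fun do rewrite eg; split; first exact: igD.
  by rewrite rmeanD //; move: r1 r2; lra.
exists g.
  (* Square integrability of g is read off from g = f_N - (f_N - g). *)
  have [N hN] := H _ ltr01; have [iN _] := hN _ (leqnn N).
  have hN2 : L2 (fun t => f N t - g t).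
    by apply/L2P; split => //; apply: cmeasB => //; exact: L2_meas.
  have := L2B (hf N) hN2; congr L2; apply/funext => t.
  by rewrite opprB addrCA subrr addr0.
apply/cvgrPdist_le => e e0; have [N hN] := H _ e0.
exists N => // n /= /hN[_]; rewrite sub0r normrN ger0_norm //.
exact: nsq_ge0.
Qed.

Lemma nsq0 : nsq (fun=> 0 : C) = 0.
Proof. by rewrite /nsq; under eq_fun do rewrite csq0; rewrite rmean_cst. Qed.

(** The free lower end m makes the difference of two Taylor polynomials again of this form. *)
Definition trigpoly c m n (t : R) : C := \sum_(m <= k < n) c k * expk k%:Z t.

Lemma trigpolyS c m n : (m <= n)%N -> trigpoly c m n.+1 =
  fun t => trigpoly c m n t + c n * expk n%:Z t.
Proof. by move=> mn; apply/funext => t; rewrite /trigpoly big_nat_recr. Qed.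

Lemma trigpoly_id c m n : (n <= m)%N -> trigpoly c m n = fun=> 0.
Proof. by move=> mn; apply/funext => t; rewrite /trigpoly big_geq. Qed.

Lemma L2_trigpoly c m n : L2 (trigpoly c m n).
Proof.
elim: n => [|n IH]; first by rewrite trigpoly_id //; exact: L2_cst.
have [mn|nm] := leqP m n; last by rewrite trigpoly_id //; exact: L2_cst.
by rewrite trigpolyS //; apply: L2D => //; apply: L2Z; exact: L2_expk.
Qed.

Lemma fcoef_cst0 k : fcoef (fun=> 0 : C) k = 0.
Proof.
rewrite fcoefE; under eq_fun do rewrite mul0r.
exact: cmean_cst.
Qed.

Lemma fcoef_trigpoly c m n (l : nat) :
  fcoef (trigpoly c m n) l%:Z = if (m <= l < n)%N then c l else 0.
Proof.
elim: n => [|n IH]; first by rewrite trigpoly_id // fcoef_cst0 ltn0 andbF.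
have [mn|nm] := leqP m n; last first.
  rewrite trigpoly_id // fcoef_cst0; case: ifP => // /andP[h1 h2].
  by move: (leq_trans nm h1); rewrite ltnNge -ltnS h2.
rewrite trigpolyS // (fcoefD _ (L2_trigpoly c m n) (L2Z (c n) (L2_expk R n))).
rewrite fcoefZ ?fcoef_expk ?IH; last exact: L2_expk.
have [/eqP[<-]|nl] := boolP (n%:Z == l%:Z).
  by rewrite ltnn andbF mn ltnSn mulr1 add0r.
rewrite mulr0 addr0 [in RHS]ltnS [in RHS](leq_eqVlt l n).
by rewrite (_ : (l == n) = false) //; apply/eqP => e; rewrite e eqxx in nl.
Qed.

Lemma fcoef_trigpoly_neg c m n (l : int) : l < 0 -> fcoef (trigpoly c m n) l = 0.
Proof.
move=> l0; elim: n => [|n IH]; first by rewrite trigpoly_id // fcoef_cst0.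
have [mn|nm] := leqP m n; last by rewrite trigpoly_id // fcoef_cst0.
rewrite trigpolyS // (fcoefD _ (L2_trigpoly c m n) (L2Z (c n) (L2_expk R n))).
rewrite fcoefZ ?fcoef_expk ?IH; last exact: L2_expk.
by case: eqP => [e|_]; [move: l0; rewrite -e|rewrite mulr0 addr0].
Qed.

Lemma nsq_sub_coef f k : L2 f ->
  nsq (fun t => f t - fcoef f k * expk k t) = nsq f - csq (fcoef f k).
Proof.
move=> hf; rewrite -(nsq_expkM (- k)) -[nsq f](nsq_expkM (- k)).
rewrite -nsqB_cmean; last exact: L2_expkM.
congr nsq; apply/funext => t; rewrite mulrBl -mulrA [expk k t * _]mulrC.
by rewrite expkNK mulr1.
Qed.

Lemma nsq_sub_trigpoly f m n : L2 f -> (m <= n)%N ->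
  nsq (fun t => f t - trigpoly (fun k => fcoef f k%:Z) m n t) =
  nsq f - \sum_(m <= k < n) csq (fcoef f k%:Z).
Proof.
move=> hf; elim: n => [|n IH] mn.
  by rewrite trigpoly_id // big_geq // subr0; congr nsq; apply/funext => t; rewrite subr0.
move: mn; rewrite leq_eqVlt => /predU1P[<-|].
  by rewrite trigpoly_id // big_geq // subr0; congr nsq; apply/funext => t; rewrite subr0.
rewrite ltnS => mn; rewrite trigpolyS // big_nat_recr //= opprD addrA -IH //.
set g := fun t => f t - trigpoly _ m n t.
have hg : L2 g by apply: L2B => //; exact: L2_trigpoly.
(* The terms already removed have frequencies below n and leave the coefficient at n unchanged. *)
have -> : fcoef f n = fcoef g n.
  by rewrite (fcoefB _ hf (L2_trigpoly _ m n)) fcoef_trigpoly ltnn andbF subr0.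
by rewrite -nsq_sub_coef //; congr nsq; apply/funext => t; rewrite opprD addrA.
Qed.

(** The polynomial is its own Taylor section, so the remainder in [nsq_sub_trigpoly] is 0. *)
Lemma nsq_trigpoly c m n : (m <= n)%N ->
  nsq (trigpoly c m n) = \sum_(m <= k < n) csq (c k).
Proof.
move=> mn; have := nsq_sub_trigpoly (L2_trigpoly c m n) mn.
have e : \sum_(m <= k < n) csq (fcoef (trigpoly c m n) k%:Z) =
    \sum_(m <= k < n) csq (c k).
  rewrite !big_nat; apply: eq_bigr => k kmn.
  by rewrite fcoef_trigpoly kmn.
rewrite e (_ : (fun t => trigpoly c m n t - _ t) = fun=> 0).
  by rewrite nsq0 => /eqP; rewrite eq_sym subr_eq0 => /eqP.
apply/funext => t; rewrite /trigpoly -sumrB big_nat big1 // => k kmn.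
by rewrite fcoef_trigpoly kmn subrr.
Qed.

(** By Bessel's inequality the Taylor polynomials form a Cauchy sequence. Their limit has the
    Fourier coefficients of h, hence equals h by uniqueness. *)
Lemma H2D_approx h : H2D h ->
  nsq (fun t => trigpoly (fun k => fcoef h k%:Z) 0 n t - h t) @[n --> \oo] --> (0 : R).
Proof.
move=> [hh h0]; set c : nat -> C := fun k => fcoef h k%:Z.
pose a n := \sum_(0 <= k < n) csq (c k).
have a_le n : a n <= nsq h.
  by have := nsq_sub_trigpoly hh (leq0n n); have := nsq_ge0
    (fun t => h t - trigpoly c 0 n t); rewrite -/c -/(a n) => p e; move: p; rewrite e subr_ge0.
have ca : cvgn a.
  apply: nondecreasing_is_cvgn; last by exists (nsq h) => _ [n _ <-].
  by apply: nondecreasing_series => k _ _; exact: csq_ge0.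
have hC e : 0 < e -> exists N, forall m n, (N <= m)%N -> (N <= n)%N ->
     nsq (fun t => trigpoly c 0 m t - trigpoly c 0 n t) <= e.
  move=> e0; have /cvgrPdist_le/(_ (e / 2)) := ca.
  rewrite divr_gt0 // => /(_ isT) [N _ hN].
  exists N.
  have H m n : (N <= m)%N -> (m <= n)%N ->
      nsq (fun t => trigpoly c 0 n t - trigpoly c 0 m t) <= e.
    move=> Nm mn.
    have -> : (fun t => trigpoly c 0 n t - trigpoly c 0 m t) = trigpoly c m n.
      by apply/funext => t; rewrite /trigpoly (@big_cat_nat _ _ _ m 0%N n) //= addrAC subrr add0r.
    rewrite nsq_trigpoly //.
    have -> : \sum_(m <= k < n) csq (c k) = a n - a m.
      by rewrite /a (@big_cat_nat _ _ _ m 0%N n) //= addrAC subrr add0r.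
    have := hN m Nm; have := hN n (leq_trans Nm mn) => /=.
    by rewrite !ler_norml => /andP[h1 h2] /andP[h3 h4]; lra.
  move=> m n Nm Nn; case/orP: (leq_total n m) => [nm|mn]; first exact: H.
  rewrite -nsqN; under eq_fun do rewrite opprB; exact: H.
have [g hg cg] := L2_complete (fun n => L2_trigpoly c 0 n) hC.
suff e : ae_circ (fun t => h t - g t = 0).
  rewrite (_ : (fun n => _) = (fun n => nsq (fun t => trigpoly c 0 n t - g t))) //.
  apply/funext => n; apply: nsq_ae.
  - by apply: cmeasB; apply: L2_meas => //; exact: L2_trigpoly.
  - by apply: cmeasB; apply: L2_meas => //; exact: L2_trigpoly.
  - by apply: ae_circS e => t _ /eqP; rewrite subr_eq0 => /eqP ->.
apply: fcoef_inj0; first exact: L2B.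
move=> k; apply: (csq_lim0 _ cg).
(* Beyond |k| the polynomial contains the frequency k if k is nonnegative; negative frequencies are
   absent on both sides. *)
exists `|k|.+1%N => // n /= kn.
suff -> : fcoef (fun t => h t - g t) k = fcoef (fun t => trigpoly c 0 n t - g t) k.
  by apply: csq_fcoef_le; apply: L2B => //; exact: L2_trigpoly.
rewrite (fcoefB _ hh hg) (fcoefB _ (L2_trigpoly c 0 n) hg); congr (_ - _).
case: k kn => k kn; last by rewrite h0 // fcoef_trigpoly_neg.
by rewrite fcoef_trigpoly leq0n kn.
Qed.

Lemma nsqM_le g h : cmeasurable g -> ae_circ (fun t => csq (g t) <= 1) -> L2 h ->
  nsq (fun t => g t * h t) <= nsq h.
Proof.
move=> mg bg hh; apply: rmean_ae_le.
- by apply: L2_ig; exact: (L2M_bounded mg bg hh).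
- exact: L2_ig.
- by apply: ae_circS bg => t _ h1; rewrite csqM ler_piMl // csq_ge0.
Qed.

(** The mean of g z^k is the coefficient of g at -k, so against a Taylor polynomial of h only the
    constant term survives. Boundedness of g makes the product continuous in h for the L^2 norm. *)
Lemma cmean_mulH2 g h : H2D g -> ae_circ (fun t => csq (g t) <= 1) -> H2D h ->
  cmean (fun t => g t * h t) = cmean g * cmean h.
Proof.
move=> hg bg hh; have [lg g0] := hg; have [lh h0] := hh.
set c : nat -> C := fun k => fcoef h k%:Z.
apply/eqP; rewrite -subr_eq0; apply/eqP.
(* From n = 1 on the polynomial contains the constant term of h. *)
apply: (csq_lim0 _ (H2D_approx hh)); exists 1%N => // n /= n0.
have key m : cmean (fun t => g t * trigpoly c 0 m.+1 t) = cmean g * cmean h.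
  elim: m => [|m IH].
    rewrite trigpolyS // trigpoly_id //.
    under eq_fun do rewrite add0r expk0 mulr1 mulrC.
    rewrite cmeanZ; last exact: cint_L2.
    by rewrite /c -/(at0 h) at0E // mulrC.
  rewrite trigpolyS //; under eq_fun do rewrite mulrDr mulrCA.
  rewrite cmeanD; first last.
  - by apply: cintZ; apply: cintM => //; exact: L2_expk.
  - by apply: cintM => //; exact: L2_trigpoly.
  rewrite IH cmeanZ; last by apply: cintM => //; exact: L2_expk.
  have /g0 : - (m.+1)%:Z < 0 by lia.
  by rewrite fcoefE opprK => ->; rewrite mulr0 addr0.
case: n n0 => // n _; rewrite -(key n) -cmeanB; first last.
- by apply: cintM => //; exact: L2_trigpoly.
- exact: cintM.
have lB : L2 (fun t => h t - trigpoly c 0 n.+1 t).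
  by apply: L2B => //; exact: L2_trigpoly.
under eq_fun do rewrite -mulrBr.
apply: le_trans (csq_cmean_le _) _.
  by apply: (L2M_bounded _ bg) => //; exact: L2_meas.
apply: le_trans (nsqM_le _ bg lB) _; first exact: L2_meas.
by rewrite -nsqN; under eq_fun do rewrite opprB.
Qed.

End Hardy.

(** * Products of pairs *)


Section PairAlgebra.
Variable R : realType.
Local Notation C := (complex R).
Implicit Types (p q r g : pair R) (F : nat -> C).

(** A pair (a, b) stands for the matrix with rows a, b and -conj b, conj a. When [det] is 1 this
    matrix lies in SU(2), and its inverse is its adjoint. Half the squared Frobenius distance of two
    such matrices is [pairdist]. *)
Definition pairinv p : pair R := (fun t => cconj (p.1 t), fun t => - p.2 t).
Definition pone : pair R := (cst 1, cst 0).
Definition det p (t : R) : R := csq (p.1 t) + csq (p.2 t).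
Definition pairdist p q (t : R) : R := csq (p.1 t - q.1 t) + csq (p.2 t - q.2 t).
(** Each stripping step divides the second entry by z. Restoring n of these factors turns n
    strippings into multiplication by the inverse of a partial product. *)
Definition twist (n : nat) p : pair R := (p.1, fun t => p.2 t * expk n%:Z t).

Lemma pair_ext p q : (forall t, p.1 t = q.1 t) -> (forall t, p.2 t = q.2 t) -> p = q.
Proof. by case: p q => [a b] [c d] /= /funext -> /funext ->. Qed.

Lemma pmulA p q r : pmul p (pmul q r) = pmul (pmul p q) r.
Proof.
by apply: pair_ext => t /=; rewrite ?(cconjD, cconjM, cconjN, cconjK); ring.
Qed.

Lemma pmul1p p : pmul pone p = p.
Proof. by apply: pair_ext => t; rewrite /= /cst; ring. Qed.

Lemma pmulp1 p : pmul p pone = p.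
Proof. by apply: pair_ext => t; rewrite /= /cst ?cconj0 ?cconj1; ring. Qed.

Lemma det_pmul p q t : det (pmul p q) t = det p t * det q t.
Proof. by rewrite /det /= /csq !reimE; ring. Qed.

Lemma det_pone t : det pone t = 1.
Proof. by rewrite /det /= /cst csq0 csq1 addr0. Qed.

Lemma pairdist_pmull g p q t : pairdist (pmul g p) (pmul g q) t = det g t * pairdist p q t.
Proof. by rewrite /det /pairdist /= /csq !reimE; ring. Qed.

Lemma pairdist_pmulr g p q t : pairdist (pmul p g) (pmul q g) t = pairdist p q t * det g t.
Proof. by rewrite /det /pairdist /= /csq !reimE; ring. Qed.

Lemma pairdist_pairinv p q t : pairdist (pairinv p) (pairinv q) t = pairdist p q t.
Proof. by rewrite /pairdist /= /csq !reimE; ring. Qed.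

Lemma pairdist_pmul_pairinv p q t : det p t = 1 -> det q t = 1 ->
  pairdist p q t = 2 - 2 * complex.Re ((pmul (pairinv q) p).1 t).
Proof.
move=> dp dq; have e : 2 = det p t + det q t by rewrite dp dq.
by rewrite [X in X - _]e /pairdist /det /= /csq !reimE; ring.
Qed.

Lemma detP p t : p.1 t * cconj (p.1 t) + p.2 t * cconj (p.2 t) = 1 <-> det p t = 1.
Proof.
rewrite !mul_cconj /det; split=> [[]//|h].
by apply: cext; rewrite /= ?addr0.
Qed.

Lemma csq_le_det p t : det p t = 1 -> csq (p.1 t) <= 1 /\ csq (p.2 t) <= 1.
Proof.
rewrite /det => <-; split; [rewrite lerDl|rewrite lerDr]; exact: csq_ge0.
Qed.

Lemma pmul_pairinvK g p : (forall t, det g t = 1) -> pmul (pairinv g) (pmul g p) = p.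
Proof.
move=> dg; have e : pmul (pairinv g) g = pone.
  apply: pair_ext => t; rewrite /= /cst; last by ring.
  have := dg t; rewrite -detP => h; rewrite -h.
  by rewrite [X in X = _](_ : _ = g.1 t * cconj (g.1 t) + g.2 t * cconj (g.2 t)) //; ring.
by rewrite pmulA e pmul1p.
Qed.

(** Stated at a single point, because it is applied to stripped pairs, whose determinant is 1 only
    almost everywhere. *)
Lemma pmulK_at p q t : det q t = 1 ->
  (p.1 t = (pmul (pmul p q) (pairinv q)).1 t) /\ (p.2 t = (pmul (pmul p q) (pairinv q)).2 t).
Proof.
rewrite -detP => h; split => /=; rewrite ?(cconjN, cconjK).
  rewrite -[LHS]mulr1 -h; ring.
by rewrite -[LHS]mulr1 -h; ring.
Qed.

Lemma nfactor_gt0 (z : C) : 0 < nfactor z.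
Proof. by rewrite sqrtr_gt0 invr_gt0 ltr_pwDl // csq_ge0. Qed.

Lemma nfactor_sq (z : C) : nfactor z ^+ 2 = (1 + csq z)^-1.
Proof. by rewrite sqr_sqrtr // invr_ge0 addr_ge0 // csq_ge0. Qed.

Lemma nfactor_le1 (z : C) : nfactor z <= 1.
Proof.
rewrite -(@ler_pXn2r _ 2) ?nnegrE ?(ltW (nfactor_gt0 z)) // nfactor_sq expr1n.
by rewrite invf_le1 ?lerDl ?csq_ge0 // ltr_pwDl // csq_ge0.
Qed.

Lemma nfactor_mul (z : C) : nfactor z * nfactor z * (1 + csq z) = 1.
Proof.
rewrite -expr2 nfactor_sq mulVf // lt0r_neq0 // ltr_pwDl // csq_ge0 //.
Qed.

Lemma nfactorV (z : C) : nfactor z * (1 + csq z) = (nfactor z)^-1.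
Proof.
have h : nfactor z != 0 by rewrite lt0r_neq0 // nfactor_gt0.
by apply: (mulfI h); rewrite mulfV // mulrA nfactor_mul.
Qed.

Definition nlf_factor F k : pair R :=
  pscale (nfactor (F k)) (cst 1, fun t => F k * expk k%:Z t).

Lemma det_nlf_factor F k t : det (nlf_factor F k) t = 1.
Proof.
rewrite /det /= /cst !csqM csq_real csq_expk csq1 !mulr1.
by rewrite -[X in X + _]mulr1 -mulrDr expr2 nfactor_mul.
Qed.

(** The free starting index keeps tails within the same family: the inverse of one partial product
    times a longer one is again a [prodfrom]. *)
Fixpoint prodfrom F (i n : nat) : pair R :=
  if n is n'.+1 then pmul (prodfrom F i n') (nlf_factor F (i + n')) else pone.

Lemma prodfrom_add F i m n :
  prodfrom F i (m + n) = pmul (prodfrom F i m) (prodfrom F (i + m) n).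
Proof.
elim: n => [|n IH]; first by rewrite addn0 pmulp1.
by rewrite addnS /= IH pmulA addnA.
Qed.

Lemma det_prodfrom F i n t : det (prodfrom F i n) t = 1.
Proof.
by elim: n => [|n IH] /=; rewrite ?det_pone // det_pmul IH det_nlf_factor mulr1.
Qed.

Lemma nlf_partialE F n : nlf_partial F n = prodfrom F 0 n.+1.
Proof.
elim: n => [|n IH]; last by rewrite /= IH.
rewrite /= pmul1p; apply: pair_ext => t //=.
by rewrite expk0 mulr1.
Qed.

Lemma strip_step1 p t : (strip_step p).1 t = Complex (nfactor (strip_coef p)) 0 *
  (p.1 t + strip_coef p * cconj (p.2 t)).
Proof.
rewrite -[LHS]/(Complex (nfactor (strip_coef p)) 0 *
  (1 * p.1 t - - strip_coef p * cconj (p.2 t))).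
by rewrite mul1r mulNr opprK.
Qed.

Lemma strip_step2 p t : (strip_step p).2 t = Complex (nfactor (strip_coef p)) 0 *
  (p.2 t - strip_coef p * cconj (p.1 t)) * expk (-1) t.
Proof.
rewrite -[LHS]/(Complex (nfactor (strip_coef p)) 0 *
  (1 * p.2 t + - strip_coef p * cconj (p.1 t)) * expk (-1) t).
by rewrite mul1r mulNr.
Qed.

Lemma strip_step_star p t : fstar (strip_step p).1 t =
  Complex (nfactor (strip_coef p)) 0 *
  (fstar p.1 t + cconj (strip_coef p) * p.2 t).
Proof. by rewrite /fstar strip_step1 !(cconjM, cconjD, cconjK) cconj_real. Qed.

Lemma nfactor_mulC (z : C) : Complex (nfactor z) 0 * Complex (nfactor z) 0 *
  (1 + z * cconj z) = 1.
Proof.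
rewrite mul_cconj; apply: cext; rewrite !reimE /=; last by ring.
by rewrite !(mul0r, mulr0, subr0, addr0) nfactor_mul.
Qed.

Lemma twist_strip F p n : F n = strip_coef p ->
  twist n p = pmul (nlf_factor F n) (twist n.+1 (strip_step p)).
Proof.
move=> e; have h := nfactor_mulC (F n).
have ez t : expk (-1) t * expk n.+1%:Z t = expk n%:Z t :> C.
  by rewrite -expkD; congr expk; lia.
have ex t : expk n%:Z t * cconj (expk n%:Z t) = 1 :> C.
  by rewrite mulrC cconj_expk expkNK.
set w := Complex (nfactor (F n)) 0 in h.
have hw : cconj w = w by exact: cconj_real.
apply: pair_ext => t.
  rewrite -[RHS]/(w * 1 * (strip_step p).1 t -
    w * (F n * expk n%:Z t) * cconj ((strip_step p).2 t * expk n.+1%:Z t)).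
  rewrite strip_step1 strip_step2 -e -/w -[w * _ * _ * _]mulrA ez.
  rewrite !(cconjM, cconjD, cconjN, cconjK) hw.
  (* The exponentials are collected as z^n times its conjugate, which is 1. What remains is the
     normalization w^2 (1 + |F_n|^2) = 1. *)
  rewrite [RHS](_ : _ = w * w * (p.1 t + F n * cconj (p.2 t)
     - F n * (expk n%:Z t * cconj (expk n%:Z t)) * (cconj (p.2 t) - cconj (F n) * p.1 t))); last by ring.
  by rewrite ex mulr1 -[LHS]/(p.1 t) -[LHS]mul1r -h; ring.
rewrite -[RHS]/(w * 1 * ((strip_step p).2 t * expk n.+1%:Z t) +
    w * (F n * expk n%:Z t) * cconj ((strip_step p).1 t)).
rewrite strip_step1 strip_step2 -e -/w -[w * _ * _ * _]mulrA ez.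
rewrite !(cconjM, cconjD, cconjN, cconjK) hw.
by rewrite mulr1 -[LHS]/(p.2 t * expk n%:Z t) -[LHS]mul1r -h; ring.
Qed.

Lemma twist_strip_pair p n :
  pmul (prodfrom (layer_strip p) 0 n) (twist n (strip_pair p n)) = p.
Proof.
elim: n => [|n IH].
  apply: etrans (pmul1p _) _; apply: pair_ext => t //.
  by rewrite -[LHS]/(p.2 t * expk 0 t) expk0 mulr1.
have e := @twist_strip (layer_strip p) (strip_pair p n) n erefl.
by rewrite -[RHS]IH e pmulA.
Qed.

End PairAlgebra.


(** * Frequencies of finite products *)

Section Products.
Variable R : realType.
Local Notation C := (complex R).
Local Notation D := (@circ R).
Implicit Types (p q : pair R) (F : nat -> C).

Definition nfprod F i n : R := \prod_(i <= k < i + n) nfactor (F k).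

Lemma nfprodS F i n : nfprod F i n.+1 = nfactor (F (i + n)%N) * nfprod F i n.
Proof. by rewrite /nfprod addnS big_nat_recr ?leq_addr //= mulrC. Qed.

Lemma nfprod_gt0 F i n : 0 < nfprod F i n.
Proof. by apply: prodr_gt0 => k _; exact: nfactor_gt0. Qed.

Lemma nfprod_cat F m n : nfprod F 0 (m + n) = nfprod F 0 m * nfprod F m n.
Proof. by rewrite /nfprod !add0n (@big_cat_nat _ _ _ m) //= leq_addr. Qed.

(* The entries of a product of the factors of index [i], ..., [i + n - 1] are
   trigonometric polynomials: the first has frequencies in [-n, 0], the second
   in [i, i + n - 1]. *)
Record product_spectrum F i n : Prop := ProductSpectrum {
  ps_star1 : H2D (fstar (prodfrom F i n).1);
  ps_shift1 : H2D (fun t => (prodfrom F i n).1 t * expk n%:Z t);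
  ps_unshift2 : H2D (fun t => (prodfrom F i n).2 t * expk (- i%:Z) t);
  ps_star2 : H2D (fun t => cconj ((prodfrom F i n).2 t) * expk (i + n)%:Z t);
  ps_mean2 : cmean (fun t => cconj ((prodfrom F i n).2 t) * expk (i + n)%:Z t) = 0;
  ps_mean1 : cmean (fstar (prodfrom F i n).1) = Complex (nfprod F i n) 0 }.

Lemma at0_shift1 (f : R -> C) : H2D f -> cmean (fun t => f t * expk 1 t) = 0.
Proof.
by move=> [_ f0]; have := f0 (-1) isT; rewrite fcoefE opprK.
Qed.

Lemma prodfromS1 F i n t : (prodfrom F i n.+1).1 t =
  Complex (nfactor (F (i + n)%N)) 0 * ((prodfrom F i n).1 t -
    (prodfrom F i n).2 t * (cconj (F (i + n)%N) * cconj (expk (i + n)%:Z t))).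
Proof.
set w := Complex _ 0; have hw : cconj w = w by exact: cconj_real.
rewrite -[LHS]/((prodfrom F i n).1 t * (w * 1) -
  (prodfrom F i n).2 t * cconj (w * (F (i + n)%N * expk (i + n)%:Z t))).
by rewrite !cconjM hw; ring.
Qed.

Lemma prodfromS2 F i n t : (prodfrom F i n.+1).2 t =
  Complex (nfactor (F (i + n)%N)) 0 * ((prodfrom F i n).2 t +
    (prodfrom F i n).1 t * (F (i + n)%N * expk (i + n)%:Z t)).
Proof.
set w := Complex _ 0; have hw : cconj w = w by exact: cconj_real.
rewrite -[LHS]/((prodfrom F i n).1 t * (w * (F (i + n)%N * expk (i + n)%:Z t)) +
  (prodfrom F i n).2 t * cconj (w * 1)).
by rewrite mulr1 hw; ring.
Qed.

Lemma H2D_eq (f g : R -> C) : f = g -> H2D f -> H2D g.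
Proof. by move=> ->. Qed.

(** All bounds go through one induction, since each new entry mixes both old ones. The zero mean in
    [ps_mean2] says that the frequency i + n is still absent from the second entry; therefore the
    next factor changes the constant term of the first only by its normalization. *)
Lemma prodfrom_spectrum F i n : product_spectrum F i n.
Proof.
elim: n => [|n [h1 h2 h3 h4 h5 h6]].
  split => /=.
  - by apply: H2D_eq (H2D_cst 1); apply/funext => t; rewrite /fstar /cst cconj1.
  - by apply: H2D_eq (H2D_cst 1); apply/funext => t; rewrite /cst expk0 mulr1.
  - by apply: H2D_eq (H2D_cst 0); apply/funext => t; rewrite /cst mul0r.
  - by apply: H2D_eq (H2D_cst 0); apply/funext => t; rewrite /cst cconj0 mul0r.
  - rewrite (_ : (fun t => _) = fun=> 0) ?cmean_cst //.
    by apply/funext => t; rewrite /cst cconj0 mul0r.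
  - rewrite /nfprod addn0 big_geq // (_ : fstar _ = fun=> 1) ?cmean_cst //.
    by apply/funext => t; rewrite /fstar /cst cconj1.
set w : C := Complex (nfactor (F (i + n)%N)) 0.
have hw : cconj w = w by exact: cconj_real.
pose a := (prodfrom F i n).1; pose b := (prodfrom F i n).2.
have ex k t : cconj (expk k t) * expk k t = 1 :> C by rewrite cconj_expk expkNK.
have sh k t : expk k.+1%:Z t = expk k%:Z t * expk 1 t :> C.
  by rewrite -expkD; congr expk; lia.
have e1 : fstar (prodfrom F i n.+1).1 = fun t => w * (fstar a t + - F (i + n)%N *
    (cconj (b t) * expk (i + n)%:Z t)).
  apply/funext => t; rewrite /fstar prodfromS1 -/w !(cconjM, cconjD, cconjN, cconjK) hw.
  by rewrite -/(a t) -/(b t); ring.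
split.
- by rewrite e1; apply: H2DZ; apply: H2D_add => //; exact: H2DZ.
- have := H2DZ w (H2D_add (H2D_shift 1 h2)
    (H2DZ (- cconj (F (i + n)%N)) (H2D_shift 1 h3))).
  apply: H2D_eq; apply/funext => t; rewrite prodfromS1 -/w -/(a t) -/(b t) (sh n).
  have -> : expk (- i%:Z) t = cconj (expk (i + n)%:Z t) * expk n%:Z t :> C.
    by rewrite cconj_expk -expkD; congr expk; lia.
  by ring.
- have := H2DZ w (H2D_add h3 (H2DZ (F (i + n)%N) h2)).
  apply: H2D_eq; apply/funext => t; rewrite prodfromS2 -/w -/(a t) -/(b t).
  have -> : expk n%:Z t = expk (i + n)%:Z t * expk (- i%:Z) t :> C.
    by rewrite -expkD; congr expk; lia.
  by ring.
- have := H2DZ w (H2D_add (H2D_shift 1 h4) (H2DZ (cconj (F (i + n)%N)) (H2D_shift 1 h1))).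
  apply: H2D_eq; apply/funext => t; rewrite prodfromS2 -/w -/(a t) -/(b t) addnS (sh (i + n)%N).
  rewrite /fstar !(cconjM, cconjD, cconjN, cconjK) hw -/(a t).
  rewrite [RHS](_ : _ = w * (cconj (b t) * expk (i + n)%:Z t * expk 1 t +
    cconj (F (i + n)%N) * (cconj (a t) * (cconj (expk (i + n)%:Z t) *
      expk (i + n)%:Z t) * expk 1 t))); last by ring.
  by rewrite ex mulr1.
- have := at0_shift1 (H2DZ w (H2D_add h4 (H2DZ (cconj (F (i + n)%N)) h1))).
  congr (cmean _ = _); apply/funext => t.
  rewrite prodfromS2 -/w -/(a t) -/(b t) addnS (sh (i + n)%N).
  rewrite /fstar !(cconjM, cconjD, cconjN, cconjK) hw -/(a t).
  rewrite [RHS](_ : _ = w * (cconj (b t) * expk (i + n)%:Z t * expk 1 t +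
    cconj (F (i + n)%N) * (cconj (a t) * (cconj (expk (i + n)%:Z t) *
      expk (i + n)%:Z t) * expk 1 t))); last by ring.
  by rewrite ex mulr1; ring.
- rewrite e1; have i1 : cint (fstar a) by apply: cint_L2; case: h1.
  have i2 : cint (fun t => cconj (b t) * expk (i + n)%:Z t).
    by apply: cint_L2; case: h4.
  rewrite cmeanZ; last by apply: cintD => //; exact: cintZ.
  rewrite cmeanD //; last exact: cintZ.
  rewrite cmeanZ // h5 mulr0 addr0 h6 nfprodS.
  by apply: cext; rewrite !reimE /=; ring.
Qed.

Lemma L2_prodfrom F i n : L2 (prodfrom F i n).1 /\ L2 (prodfrom F i n).2.
Proof.
have [[l1 _] _ [l2 _] _ _ _] := prodfrom_spectrum F i n; split.
  by have := L2_conj l1; congr L2; apply/funext => t; rewrite /fstar cconjK.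
have := L2_expkM i%:Z l2; congr L2; apply/funext => t.
by rewrite -mulrA expkNK mulr1.
Qed.

Lemma H2D_prodfrom2 F i n : H2D (prodfrom F i n).2.
Proof.
have h := H2D_shift i (ps_unshift2 (prodfrom_spectrum F i n)).
by apply: H2D_eq h; apply/funext => t; rewrite -mulrA expkNK mulr1.
Qed.

(* The lowest frequency of the second entry determines the first factor. *)
Lemma fcoef_prodfrom F i n : fcoef (prodfrom F i n.+1).2 i%:Z =
  F i * cmean (fstar (prodfrom F i n.+1).1).
Proof.
have [[l1 _] _ [_ h3] _ _ m1] := prodfrom_spectrum F i.+1 n.
set w : C := Complex (nfactor (F i)) 0.
have hw : cconj w = w by exact: cconj_real.
pose a := (prodfrom F i.+1 n).1; pose b := (prodfrom F i.+1 n).2.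
have e : prodfrom F i n.+1 = pmul (nlf_factor F i) (prodfrom F i.+1 n).
  have := prodfrom_add F i 1 n; rewrite add1n addn1 => ->; congr pmul.
  by apply: etrans (pmul1p _) _; rewrite addn0.
have [_ lb] : L2 a /\ L2 b by exact: L2_prodfrom.
have e2 : (prodfrom F i n.+1).2 =
    fun t => w * (b t + F i * (fstar a t * expk i%:Z t)).
  rewrite e; apply/funext => t.
  rewrite -[LHS]/(w * 1 * b t + w * (F i * expk i%:Z t) * cconj (a t)).
  by rewrite /fstar; ring.
have e1 : fstar (prodfrom F i n.+1).1 =
    fun t => w * (fstar a t + - cconj (F i) * (b t * expk (- i%:Z) t)).
  rewrite e; apply/funext => t.
  rewrite -[LHS]/(cconj (w * 1 * a t - w * (F i * expk i%:Z t) * cconj (b t))).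
  by rewrite !(cconjM, cconjD, cconjN, cconjK) hw cconj_expk cconj1 /fstar; ring.
(* The remaining product starts at index i + 1, so its second entry has no frequency i. *)
have b0 : fcoef b i%:Z = 0.
  have := h3 (-1) isT; rewrite fcoef_shift; congr (fcoef _ _ = _); lia.
have lS : L2 (fun t => fstar a t * expk i%:Z t) by exact: L2_expkM.
rewrite e2 e1 fcoefZ; last by apply: L2D => //; exact: L2Z.
rewrite fcoefD //; last exact: L2Z.
rewrite b0 add0r fcoefZ // fcoef_shift subrr -/(at0 _) at0E //.
rewrite cmeanZ; last first.
  apply: cintD; first exact: cint_L2.
  by apply: cintZ; apply: cint_L2; exact: L2_expkM.
rewrite cmeanD; last 2 first.
- exact: cint_L2.
- by apply: cintZ; apply: cint_L2; exact: L2_expkM.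
rewrite cmeanZ; last by apply: cint_L2; exact: L2_expkM.
rewrite -[cmean (fun t => b t * _)]/(fcoef b i%:Z) b0 mulr0 addr0.
by rewrite mulrCA.
Qed.

End Products.

(** * Layer stripping *)


Section Stripping.
Variable R : realType.
Local Notation C := (complex R).
Local Notation D := (@circ R).
Implicit Types (p q : pair R) (F : nat -> C).

(** Positivity at infinity is relaxed to nonvanishing, so that the quotient of a pair by an inner
    function, whose value at 0 may have any phase, can be stripped as well. *)
Record prehbar p : Prop := Prehbar {
  ph_star1 : H2D (fstar p.1);
  ph_2 : H2D p.2;
  ph_det : ae_circ (fun t => det p t = 1);
  ph_at0 : at0 (fstar p.1) != 0 }.

Lemma L2_unstar (f : R -> C) : L2 (fstar f) -> L2 f.
Proof.
move=> /L2_conj; congr L2; apply/funext => t; exact: cconjK.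
Qed.

Lemma ph_L2 p : prehbar p -> L2 p.1 /\ L2 p.2.
Proof. by move=> [[h1 _] [h2 _] _ _]; split => //; exact: L2_unstar. Qed.

Lemma inL_at0 p : inL p ->
  at0 (fstar p.1) = Complex (complex.Re (at_infty p.1)) 0 /\
  0 < complex.Re (at_infty p.1).
Proof.
move=> [_ [_ [_ [_ [h1 h2]]]]]; split => //; apply: cext => //=.
by move: h1 => /= /eqP; rewrite oppr_eq0 => /eqP.
Qed.

Lemma prehbar_inL p : inL p -> H2D p.2 -> prehbar p.
Proof.
move=> hL h2; have [e h0] := inL_at0 hL; have [_ [_ [hd [h1 _]]]] := hL; split => //.
  by apply: ae_circS hd => t _ /detP.
rewrite e; apply/eqP => h.
have h' : complex.Re (at_infty p.1) = 0 := congr1 (@complex.Re R) h.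
by rewrite h' ltxx in h0.
Qed.

(** Since b(0) = F A(0), the new value is nfactor (1 + |F|^2) A(0), and nfactor^2 (1 + |F|^2) =
    1. *)
Lemma strip_at0 p : prehbar p -> at0 (fstar (strip_step p).1) =
  Complex (nfactor (strip_coef p))^-1 0 * at0 (fstar p.1).
Proof.
move=> [[h1 _] [h2 _] hd h0].
have -> : fstar (strip_step p).1 = fun t => Complex (nfactor (strip_coef p)) 0 *
  (fstar p.1 t + cconj (strip_coef p) * p.2 t).
  by apply/funext => t; exact: strip_step_star.
rewrite /at0 fcoefZ; last by apply: L2D => //; exact: L2Z.
rewrite fcoefD //; last exact: L2Z.
rewrite fcoefZ // -/(at0 p.2) -/(at0 (fstar p.1)).
have e : at0 p.2 = strip_coef p * at0 (fstar p.1) by rewrite divfK.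
rewrite e mulrA [cconj _ * _]mulrC -[X in X + _]mul1r -mulrDl mulrA; congr (_ * _).
by rewrite mul_cconj -nfactorV; apply: cext; rewrite !reimE /=; ring.
Qed.

Lemma det_strip p t : det (strip_step p) t = det p t.
Proof.
rewrite /det strip_step1 strip_step2 !csqM csq_expk mulr1 csq_real -mulrDr.
set c := strip_coef p.
have -> : csq (p.1 t + c * cconj (p.2 t)) + csq (p.2 t - c * cconj (p.1 t)) =
  (1 + csq c) * (csq (p.1 t) + csq (p.2 t)) by rewrite /csq !reimE; ring.
by rewrite mulrA expr2 nfactor_mul mul1r.
Qed.

Lemma prehbar_strip p : prehbar p -> prehbar (strip_step p).
Proof.
move=> hp; have [h1 h2 hd h0] := hp; split.
- apply: H2D_eq (H2DZ (Complex (nfactor (strip_coef p)) 0)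
    (H2D_add h1 (H2DZ (cconj (strip_coef p)) h2))).
  by apply/funext => t; rewrite strip_step_star.
- pose f t := Complex (nfactor (strip_coef p)) 0 *
    (p.2 t + - strip_coef p * fstar p.1 t).
  have hf : H2D f by apply: H2DZ; apply: H2D_add => //; exact: H2DZ.
  (* The stripping coefficient is chosen to cancel the constant term, which makes the division by z
     possible within H^2(D). *)
  have f0 : at0 f = 0.
    rewrite /at0 fcoefZ; last by apply: L2D; [case: h2|apply: L2Z; case: h1].
    rewrite fcoefD; [|by case: h2|by apply: L2Z; case: h1].
    rewrite fcoefZ; last by case: h1.
    by rewrite -/(at0 p.2) -/(at0 (fstar p.1)) mulNr divfK // subrr mulr0.
  apply: H2D_eq (H2D_unshift hf f0).
  by apply/funext => t; rewrite strip_step2 /f mulNr.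
- by apply: ae_circS hd => t _; rewrite det_strip.
- rewrite strip_at0 // mulf_neq0 //; apply/eqP => /(congr1 (@complex.Re R)) /= /eqP.
  by rewrite invr_eq0 (negbTE (lt0r_neq0 (nfactor_gt0 _))).
Qed.

Lemma prehbar_strip_pair p n : prehbar p -> prehbar (strip_pair p n).
Proof. by move=> hp; elim: n => //= n; exact: prehbar_strip. Qed.

Lemma strip_pair_at0 p n : prehbar p ->
  at0 (fstar (strip_pair p n).1) =
  Complex (nfprod (layer_strip p) 0 n)^-1 0 * at0 (fstar p.1).
Proof.
move=> hp; elim: n => [|n IH].
  by rewrite /nfprod big_geq //= invr1 mul1r.
rewrite [LHS]strip_at0; last exact: prehbar_strip_pair.
rewrite IH nfprodS mulrA; congr (_ * _).
rewrite invfM; apply: cext; rewrite !reimE /=; last by ring.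
by rewrite mulr0 subr0.
Qed.

Lemma csq_at0_le1 p : prehbar p -> csq (at0 (fstar p.1)) <= 1.
Proof.
move=> [[h1 _] _ hd _]; rewrite at0E //; apply: le_trans (csq_cmean_le h1) _.
rewrite -[leRHS](@rmean_cst R 1); apply: rmean_ae_le; [exact: L2_ig|exact: ig_cst|].
by apply: ae_circS hd => t _ /csq_le_det[+ _]; rewrite /fstar csq_conj.
Qed.

Lemma csq_at0_le p n : prehbar p ->
  csq (at0 (fstar p.1)) <= nfprod (layer_strip p) 0 n ^+ 2.
Proof.
move=> hp; have := csq_at0_le1 (prehbar_strip_pair n hp).
rewrite strip_pair_at0 // csqM csq_real exprVn mulrC ler_pdivrMr ?mul1r //.
by rewrite exprn_gt0 // nfprod_gt0.
Qed.

(** This is 1 + sum |F_k|^2 <= prod (1 + |F_k|^2), cleared of denominators. *)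
Lemma sum_csq_le F n :
  (1 + \sum_(0 <= k < n) csq (F k)) * nfprod F 0 n ^+ 2 <= 1.
Proof.
elim: n => [|n IH]; first by rewrite /nfprod !big_geq // addr0 mul1r expr1n.
apply: le_trans IH; rewrite big_nat_recr //= nfprodS add0n exprMn nfactor_sq.
set s := \sum_(_ <= _ < _) _; set c := csq (F n).
have c0 : 0 <= c by exact: csq_ge0.
have s0 : 0 <= s by apply: sumr_ge0 => k _; exact: csq_ge0.
have c1 : 0 < 1 + c by rewrite ltr_pwDl.
rewrite mulrA; apply: ler_wpM2r; first exact: sqr_ge0.
rewrite ler_pdivrMr // mulrDl mul1r addrA mulrDr mulr1.
by have := mulr_ge0 s0 c0; lra.
Qed.

Lemma sqsum_strip p : prehbar p -> sqsum (layer_strip p).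
Proof.
move=> hp; apply: nondecreasing_is_cvgn.
  by apply: nondecreasing_series => k _ _; exact: csq_ge0.
(* The partial sums are bounded by |A(0)|^(-2), because |A(0)|^2 is at most the squared product in
   [sum_csq_le]. *)
exists (csq (at0 (fstar p.1)))^-1 => _ [n _ <-]; rewrite /series /=.
have h := sum_csq_le (layer_strip p) n; have h2 := csq_at0_le n hp.
have a0 : 0 < csq (at0 (fstar p.1)) by apply: csq_gt0; exact: ph_at0.
set s := \sum_(_ <= _ < _) _ in h *.
have s0 : 0 <= s by apply: sumr_ge0 => k _; exact: csq_ge0.
rewrite -[leRHS]mul1r ler_pdivlMr //; apply: le_trans h.
by apply: ler_pM => //; [exact: csq_ge0|lra].
Qed.

(** Unlike the sum of two norms in [rho], this squared distance is invariant under multiplication by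
    a unitary pair. *)
Definition dmean p q : R :=
  nsq (fun t => p.1 t - q.1 t) + nsq (fun t => p.2 t - q.2 t).

Lemma dmeanE p q : L2 p.1 -> L2 p.2 -> L2 q.1 -> L2 q.2 ->
  ig (pairdist p q) /\ dmean p q = rmean (pairdist p q).
Proof.
move=> p1 p2 q1 q2; rewrite /dmean /nsq -rmeanD; try by apply: L2_ig; exact: L2B.
by split => //; apply: igD; apply: L2_ig; exact: L2B.
Qed.

Lemma dmean_pairinv p q : L2 p.1 -> L2 p.2 -> L2 q.1 -> L2 q.2 ->
  ae_circ (fun t => det p t = 1) -> ae_circ (fun t => det q t = 1) ->
  dmean p q = 2 - 2 * complex.Re (cmean (pmul (pairinv q) p).1).
Proof.
move=> p1 p2 q1 q2 dp dq; have [i ->] := dmeanE p1 p2 q1 q2.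
have [c1 c2] : cint (pmul (pairinv q) p).1.
  have := cintD (cintM (L2_conj q1) p1) (cintM q2 (L2_conj p2)).
  by congr cint; apply/funext => t; rewrite /= mulNr opprK.
have j : ig (fun t => 2 * complex.Re ((pmul (pairinv q) p).1 t)) by exact: igZ.
rewrite (@rmean_ae _ _ (fun t => 2 - 2 * complex.Re ((pmul (pairinv q) p).1 t))).
- by rewrite rmeanB ?rmean_cst ?rmeanZ //; exact: ig_cst.
- exact: ig_meas.
- by apply: ig_meas; apply: igB => //; exact: ig_cst.
- by apply: (ae_circS2 _ dp dq) => t _ h1 h2; exact: pairdist_pmul_pairinv.
Qed.

Lemma nfprod_le1 F i n : nfprod F i n <= 1.
Proof.
elim: n => [|n IH]; first by rewrite /nfprod addn0 big_geq.
rewrite nfprodS mulr_ile1 //; first exact: ltW (nfactor_gt0 _).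
  exact: ltW (nfprod_gt0 _ _ _).
exact: nfactor_le1.
Qed.

(** The distance depends only on the tail product, whose first entry has mean [nfprod F m n]. *)
Lemma dmean_prodfrom F m n :
  dmean (prodfrom F 0 (m + n)) (prodfrom F 0 m) = 2 - 2 * nfprod F m n.
Proof.
have [a1 a2] := L2_prodfrom F 0 (m + n); have [b1 b2] := L2_prodfrom F 0 m.
rewrite dmean_pairinv //; try by apply: ae_circW => t; exact: det_prodfrom.
rewrite prodfrom_add pmul_pairinvK; last by move=> t; exact: det_prodfrom.
have e := ps_mean1 (prodfrom_spectrum F m n).
have [c1 c2] := L2_prodfrom F m n.
by move: e; rewrite cmean_conj ?add0n; [move/(congr1 (@complex.Re R)) => /= ->|exact: cint_L2].
Qed.

Lemma dmean_strip p n : prehbar p ->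
  dmean p (prodfrom (layer_strip p) 0 n) =
  2 - 2 * complex.Re (at0 (fstar (strip_pair p n).1)).
Proof.
move=> hp; have [p1 p2] := ph_L2 hp; have [a1 a2] := L2_prodfrom (layer_strip p) 0 n.
have hn := prehbar_strip_pair n hp; have [[l _] _ _ _] := hn.
rewrite dmean_pairinv //; [|exact: ph_det|by apply: ae_circW => t; exact: det_prodfrom].
rewrite -[X in pmul _ X](twist_strip_pair p n) pmul_pairinvK; last first.
  by move=> t; exact: det_prodfrom.
rewrite at0E // cmean_conj //; apply: cint_L2; exact: L2_unstar.
Qed.

End Stripping.

(** * The nonlinear Fourier series determines its sequence *)


Section Forward.
Variable R : realType.
Local Notation C := (complex R).
Local Notation D := (@circ R).
Implicit Types (p q : pair R) (F : nat -> C).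

Lemma squeeze0 (u v : nat -> R) : (forall n, 0 <= u n) ->
  (\forall n \near \oo, u n <= v n) -> v n @[n --> \oo] --> (0 : R) ->
  u n @[n --> \oo] --> (0 : R).
Proof.
move=> u0 uv hv; apply: (@squeeze_cvgr _ _ _ R (fun=> 0) v) => //.
  by apply: filterS uv => n ->; rewrite u0.
exact: cvg_cst.
Qed.

Lemma fcoef_lim (f : nat -> R -> C) (g : R -> C) (k : int) (z : C) :
  (forall n, L2 (f n)) -> L2 g -> nsq (fun t => f n t - g t) @[n --> \oo] --> (0 : R) ->
  (\forall n \near \oo, fcoef (f n) k = z) -> fcoef g k = z.
Proof.
move=> hf hg c0 hz; apply/esym/eqP; rewrite -subr_eq0; apply/eqP.
apply: (csq_lim0 _ c0); apply: filterS hz => n <-.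
rewrite -fcoefB //; apply: csq_fcoef_le; exact: L2B.
Qed.

Lemma H2D_lim (f : nat -> R -> C) (g : R -> C) :
  (forall n, H2D (f n)) -> L2 g -> nsq (fun t => f n t - g t) @[n --> \oo] --> (0 : R) ->
  H2D g.
Proof.
move=> hf hg c0; split => // k k0; apply: (fcoef_lim _ hg c0).
  by move=> n; case: (hf n).
by apply: nearW => n; case: (hf n) => _; exact.
Qed.

Lemma dmean_nsq p q : nsq (fun t => p.1 t - q.1 t) <= dmean p q /\
  nsq (fun t => p.2 t - q.2 t) <= dmean p q.
Proof. by rewrite /dmean lerDl lerDr !nsq_ge0. Qed.

Lemma dmean_ge0 p q : 0 <= dmean p q.
Proof. by rewrite addr_ge0 ?nsq_ge0. Qed.

Lemma dmeanC p q : dmean p q = dmean q p.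
Proof.
by rewrite /dmean -[X in X + _]nsqN -[X in _ + X]nsqN; congr (nsq _ + nsq _);
  apply/funext => t; rewrite opprB.
Qed.

Lemma dmean_cvg (P : nat -> pair R) p : dmean (P n) p @[n --> \oo] --> (0 : R) ->
  nsq (fun t => (P n).1 t - p.1 t) @[n --> \oo] --> (0 : R) /\
  nsq (fun t => (P n).2 t - p.2 t) @[n --> \oo] --> (0 : R).
Proof.
move=> h; split; apply: (squeeze0 _ _ h) => [n|]; try exact: nsq_ge0;
  by apply: nearW => n; have [] := dmean_nsq (P n) p.
Qed.

Lemma Re_at_infty_prodfrom F n :
  complex.Re (at_infty (prodfrom F 0 n).1) = nfprod F 0 n.
Proof.
have [[l _] _ _ _ _ e] := prodfrom_spectrum F 0 n.
by rewrite [LHS]/(complex.Re (at0 _)) at0E // e.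
Qed.

Lemma nlfs_cvg F p : is_NLFS F p ->
  dmean (prodfrom F 0 n) p @[n --> \oo] --> (0 : R) /\
  nfprod F 0 n @[n --> \oo] --> complex.Re (at_infty p.1).
Proof.
move=> [hL hr]; have [_ c0] := inL_at0 hL.
have h0 k (f : R -> C) : 0 <= L2norm f by exact: sqrtr_ge0.
have sq f : nsq f = L2norm f * L2norm f by rewrite L2normE -expr2 sqr_sqrtr ?nsq_ge0.
split.
  (* The partial series of index n has n + 1 factors, hence the shift. *)
  rewrite -cvg_shiftS.
  apply: (@squeeze0 _ (fun n => rho (nlf_partial F n) p * rho (nlf_partial F n) p)).
  - by move=> n; exact: dmean_ge0.
  (* With x, y the two norms and z the logarithmic term, x^2 + y^2 <= (x + y + z)^2. *)
  - apply: nearW => n; rewrite -nlf_partialE /dmean !sq /rho.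
    set x := L2norm _; set y := L2norm _; set z := `|_|.
    have x0 : 0 <= x by exact: sqrtr_ge0.
    have y0 : 0 <= y by exact: sqrtr_ge0.
    have z0 : 0 <= z by exact: normr_ge0.
    have := mulr_ge0 x0 y0; have := mulr_ge0 x0 z0; have := mulr_ge0 y0 z0.
    have := mulr_ge0 z0 z0; rewrite !mulrDl !mulrDr.
    by rewrite [y * x]mulrC [z * x]mulrC [z * y]mulrC; lra.
  - by rewrite -[X in _ --> X](mulr0 0); exact: cvgM.
have lc : ln (nfprod F 0 n.+1) @[n --> \oo] --> ln (complex.Re (at_infty p.1)).
  apply/cvgrPdist_le => e e0; have /cvgrPdist_le/(_ _ e0) := hr.
  apply: filterS => n; rewrite sub0r normrN ger0_norm; last first.
    by rewrite !addr_ge0 // ?normr_ge0 // sqrtr_ge0.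
  apply: le_trans; rewrite /rho nlf_partialE Re_at_infty_prodfrom distrC lerDr.
  by rewrite addr_ge0 // sqrtr_ge0.
rewrite -cvg_shiftS; move: c0 lc; set c := complex.Re _ => c0 lc.
have ec : expR (ln c) = c by rewrite lnK.
rewrite -ec.
rewrite (_ : (fun n => _) = expR \o (fun n => ln (nfprod F 0 n.+1))); last first.
  by apply/funext => n /=; rewrite lnK ?posrE ?nfprod_gt0.
by apply: continuous_cvg => //; exact: continuous_expR.
Qed.

Lemma nlfs_prehbar F p : is_NLFS F p -> prehbar p.
Proof.
move=> h; have [hL _] := h; have [c1 _] := nlfs_cvg h; have [_ c2] := dmean_cvg c1.
have [_ [m2 [hd _]]] := hL.
apply: prehbar_inL => //; apply: (H2D_lim _ _ c2); first by move=> n; exact: H2D_prodfrom2.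
apply: (@L2_bounded _ _ 1) => //.
by apply: ae_circS hd => t _ /detP/csq_le_det[].
Qed.

Lemma prodfrom_eq F G i n : (forall k, (k < i + n)%N -> F k = G k) ->
  prodfrom F i n = prodfrom G i n.
Proof.
elim: n => // n IH h /=; rewrite IH; last by move=> k kn; rewrite h // addnS ltnS ltnW.
by rewrite /nlf_factor h // addnS.
Qed.

Lemma L2_pmul_prodfrom F i n p : L2 p.1 -> L2 p.2 ->
  L2 (pmul (pairinv (prodfrom F i n)) p).1 /\ L2 (pmul (pairinv (prodfrom F i n)) p).2.
Proof.
move=> p1 p2; have [[m1 _] [m2 _]] := L2_prodfrom F i n.
have b1 : ae_circ (fun t => csq (cconj ((prodfrom F i n).1 t)) <= 1).
  by apply: ae_circW => t; rewrite csq_conj; have [] := csq_le_det (det_prodfrom F i n t).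
have b2 : ae_circ (fun t => csq (- (prodfrom F i n).2 t) <= 1).
  by apply: ae_circW => t; rewrite csqN; have [] := csq_le_det (det_prodfrom F i n t).
have mc := cmeas_conj m1; have mn := cmeasN m2.
split.
  by apply: L2B; [exact: L2M_bounded b1 p1|apply: (L2M_bounded _ b2) => //; exact: L2_conj].
by apply: L2D; [exact: L2M_bounded b1 p2|apply: (L2M_bounded _ b2) => //; exact: L2_conj].
Qed.

(** Once the first n coefficients agree, the pair stripped n times is, up to the twist, the L^2
    limit of the tail products starting at n. Each tail satisfies [fcoef_prodfrom] exactly, and this
    relation survives the limit and determines the next coefficient. *)
Lemma layer_strip_nlfs F p : is_NLFS F p -> forall n, layer_strip p n = F n.
Proof.
move=> h; have hp := nlfs_prehbar h; have [c1 _] := nlfs_cvg h.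
have [p1 p2] := ph_L2 hp.
elim/ltn_ind => n IH.
have eG : prodfrom (layer_strip p) 0 n = prodfrom F 0 n by exact: prodfrom_eq.
set G := prodfrom F 0 n in eG.
have dG t : det (pairinv G) t = 1.
  by rewrite /det /= csq_conj csqN; exact: det_prodfrom.
pose X := pmul (pairinv G) p.
have eX : twist n (strip_pair p n) = X.
  rewrite /X -[X in _ = pmul _ X](twist_strip_pair p n) eG pmul_pairinvK //.
  by move=> t; exact: det_prodfrom.
have [X1 X2] : L2 X.1 /\ L2 X.2 by exact: L2_pmul_prodfrom.
have eT m : pmul (pairinv G) (prodfrom F 0 (m + n.+1)) = prodfrom F n m.+1.
  rewrite addnC addSnnS prodfrom_add pmul_pairinvK //.
  by move=> t; exact: det_prodfrom.
have key : fcoef X.2 n%:Z = F n * cmean (fstar X.1).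
  apply/eqP; rewrite -subr_eq0; apply/eqP.
  (* The constant comes from [csqD_le]: the coefficient of the second entry contributes 2, the mean
     of the first, weighted by F n, contributes 2 |F n|^2. *)
  have c2 : (2 + 2 * csq (F n)) * dmean (prodfrom F 0 (m + n.+1)) p @[m --> \oo] --> (0 : R).
    rewrite -[X in _ --> X](mulr0 (2 + 2 * csq (F n))); apply: cvgM; first exact: cvg_cst.
    by rewrite (cvg_shiftn n.+1 (fun m => dmean (prodfrom F 0 m) p)).
  apply: (csq_lim0 _ c2); apply: nearW => m.
  have [T1 T2] := L2_prodfrom F n m.+1; set T := prodfrom F n m.+1 in T1 T2.
  have q1 : L2 (fun t => X.1 t - T.1 t) by exact: L2B.
  have q2 : L2 (fun t => X.2 t - T.2 t) by exact: L2B.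
  have eD : dmean X T = dmean (prodfrom F 0 (m + n.+1)) p.
    have [l1 l2] := L2_prodfrom F 0 (m + n.+1).
    have [_ ->] := dmeanE X1 X2 T1 T2; rewrite dmeanC; have [_ ->] := dmeanE p1 p2 l1 l2.
    congr rmean; apply/funext => t.
    by rewrite /T -(eT m) pairdist_pmull dG mul1r.
  have -> : fcoef X.2 n%:Z - F n * cmean (fstar X.1) =
      fcoef (fun t => X.2 t - T.2 t) n%:Z - F n * cconj (cmean (fun t => X.1 t - T.1 t)).
    rewrite fcoefB // [in RHS]cmeanB; try exact: cint_L2.
    rewrite cconjD cconjN -!cmean_conj; try exact: cint_L2.
    by rewrite /T fcoef_prodfrom /fstar; ring.
  apply: le_trans (csqD_le _ _) _; rewrite csqN csqM csq_conj -eD.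
  have [d1 d2] := dmean_nsq X T.
  have h1 := le_trans (csq_fcoef_le n%:Z q2) d2.
  have h2 := ler_wpM2l (csq_ge0 (F n)) (le_trans (csq_cmean_le q1) d1).
  have -> : (2 + 2 * csq (F n)) * dmean X T =
    2 * dmean X T + 2 * (csq (F n) * dmean X T) by ring.
  by lra.
have hn := prehbar_strip_pair n hp; have [[l _] _ _ hn0] := hn.
have e2 : fcoef X.2 n%:Z = at0 (strip_pair p n).2.
  by rewrite -eX fcoef_shift subrr.
have e1 : cmean (fstar X.1) = at0 (fstar (strip_pair p n).1) by rewrite -eX at0E.
rewrite e1 e2 in key; rewrite /layer_strip /strip_coef key mulfK //.
Qed.

(** Evaluation at 0 is multiplicative here, so g(0) cancels from the quotient; it is nonzero because
    it divides the nonzero value of p. *)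
Lemma strip_coef_inner p q (g : R -> C) : prehbar p -> prehbar q -> H2D g ->
  ae_circ (fun t => csq (g t) <= 1) ->
  ae_circ (fun t => fstar p.1 t = g t * fstar q.1 t) ->
  ae_circ (fun t => p.2 t = g t * q.2 t) ->
  at0 (fstar p.1) = at0 g * at0 (fstar q.1) /\ strip_coef p = strip_coef q.
Proof.
move=> hp hq hg bg e1 e2.
have [[p1 _] [p2 _] _ p0] := hp; have [q1 q2 _ q0] := hq; have [lg _] := hg.
have [lq1 _] := q1; have [lq2 _] := q2.
have E (f h : R -> C) : L2 f -> H2D h -> ae_circ (fun t => f t = g t * h t) ->
    at0 f = at0 g * at0 h.
  move=> lf hh e; have [lh _] := hh; rewrite !at0E // -cmean_mulH2 //.
  by apply: cmean_ae => //; [exact: L2_meas|apply: cmeasM; exact: L2_meas].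
have a1 := E _ _ p1 q1 e1; have a2 := E _ _ p2 q2 e2.
split => //; rewrite /strip_coef a1 a2.
have g0 : at0 g != 0 by apply/eqP => g0; move/eqP: p0; apply; rewrite a1 g0 mul0r.
by rewrite invfM mulrACA mulfV // mul1r.
Qed.

(** Expressed through the star of the first entry and the second entry, a stripping step is a linear
    combination without conjugates, so the common factor g persists. *)
Lemma layer_strip_inner p q (g : R -> C) : prehbar p -> prehbar q -> H2D g ->
  ae_circ (fun t => csq (g t) <= 1) ->
  ae_circ (fun t => fstar p.1 t = g t * fstar q.1 t) ->
  ae_circ (fun t => p.2 t = g t * q.2 t) ->
  forall n, layer_strip p n = layer_strip q n.
Proof.
move=> hp hq hg bg e1 e2 n.
suff [f1 f2] : ae_circ (fun t => fstar (strip_pair p n).1 t = g t * fstar (strip_pair q n).1 t) /\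
    ae_circ (fun t => (strip_pair p n).2 t = g t * (strip_pair q n).2 t).
  by have [] := strip_coef_inner (prehbar_strip_pair n hp) (prehbar_strip_pair n hq) hg bg f1 f2.
elim: n => // n [f1 f2].
have [_ es] := strip_coef_inner (prehbar_strip_pair n hp) (prehbar_strip_pair n hq) hg bg f1 f2.
split; apply: (ae_circS2 _ f1 f2) => t _ h1 h2.
  by rewrite [LHS]strip_step_star [in RHS]strip_step_star es h1 h2; ring.
rewrite [LHS]strip_step2 [in RHS]strip_step2 es h2.
by rewrite -[cconj (_.1 t)]/(fstar _ t) h1 -[cconj (_.1 t)]/(fstar _ t); ring.
Qed.

(** By the variance identity the mean of |g - g(0)|^2 is 1 - |g(0)|^2. *)
Lemma const_inner (g : R -> C) : inner g -> 1 <= csq (at0 g) -> const_ae g.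
Proof.
move=> [[lg _] g1] h; exists (at0 g).
have lB : L2 (fun t => g t - at0 g) by apply: L2B => //; exact: L2_cst.
have n1 : nsq g = 1.
  rewrite -[RHS](@rmean_cst R 1); apply: rmean_ae => //; last exact: measurable_cst.
  exact: rmeas_csq (L2_meas lg).
have n0 : nsq (fun t => g t - at0 g) = 0.
  apply/eqP; rewrite eq_le nsq_ge0 andbT at0E // nsqB_cmean // -at0E // n1.
  by rewrite subr_le0.
by apply: ae_circS (nsq_eq0 lB n0) => t _ /eqP; rewrite subr_eq0 => /eqP.
Qed.

Lemma inH_nlfs F p : is_NLFS F p -> inH p.
Proof.
move=> h; have hp := nlfs_prehbar h; have [hL _] := h; have hs := layer_strip_nlfs h.
split; first by split => //; exact: ph_2.
move=> g gi hA hb; have [hg g1] := gi.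
(* The quotient by g is formed inside the disc, with A, and conjugated back to give a first
   entry. *)
pose q : pair R := (fun t => cconj (fstar p.1 t / g t), fun t => p.2 t / g t).
have q1 : fstar q.1 = fun t => fstar p.1 t / g t.
  by apply/funext => t; rewrite /fstar /= cconjK.
have gn0 : ae_circ (fun t => g t != 0).
  apply: ae_circS g1 => t _ e; apply/eqP => g0; move/eqP: e.
  by rewrite g0 csq0 eq_sym oner_eq0.
have e1 : ae_circ (fun t => fstar p.1 t = g t * fstar q.1 t).
  by apply: ae_circS gn0 => t _ g0; rewrite q1 mulrC divfK.
have e2 : ae_circ (fun t => p.2 t = g t * q.2 t).
  by apply: ae_circS gn0 => t _ g0; rewrite /= mulrC divfK.
have g1' : ae_circ (fun t => csq (g t) <= 1) by apply: ae_circS g1 => t _ ->.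
have a0 : at0 (fstar p.1) = at0 g * at0 (fstar q.1).
  have [l1 _] := ph_star1 hp; have [lg _] := hg; rewrite q1; have [lA _] := hA.
  rewrite !at0E // -cmean_mulH2 //; apply: cmean_ae; first exact: L2_meas.
    by apply: cmeasM; exact: L2_meas.
  by apply: ae_circS e1 => t _ h1; rewrite [LHS]h1 q1.
have hq : prehbar q.
  split => //; first by rewrite q1.
    have gd := ae_circS2 (fun t (_ : D t) (x : csq (g t) = 1) (y : g t != 0) => conj x y) g1 gn0.
    apply: (ae_circS2 _ gd (ph_det hp)) => t _ [c1 c2].
    by rewrite /det /= csq_conj !csq_div // c1 !divr1 csq_conj.
  apply/eqP => z; have /eqP := ph_at0 hp; apply; by rewrite a0 z mulr0.
have sq n : layer_strip q n = F n.
  by rewrite -hs; apply/esym; exact: layer_strip_inner e1 e2 n.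
have eF : layer_strip q = F by apply/funext.
have [_ c1] := nlfs_cvg h; have [ea c0] := inL_at0 hL.
set c := complex.Re _ in c1 ea c0.
have cle : csq (at0 (fstar q.1)) <= c ^+ 2.
  have c2 : nfprod F 0 n ^+ 2 @[n --> \oo] --> c ^+ 2.
    by rewrite expr2; under eq_fun do rewrite expr2; exact: cvgM.
  rewrite -(cvg_lim (@Rhausdorff R) c2); apply: limr_ge.
    by apply/cvg_ex; exists (c ^+ 2).
  by apply: nearW => n; rewrite -eF; exact: csq_at0_le.
apply: const_inner => //.
have : c ^+ 2 = csq (at0 g) * csq (at0 (fstar q.1)) by rewrite -csqM -a0 ea csq_real.
move=> ec; have cc : 0 < c ^+ 2 by rewrite exprn_gt0.
rewrite -(ler_pM2r cc) mul1r {1}ec; apply: ler_wpM2l => //; exact: csq_ge0.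
Qed.

End Forward.

(** * Pairs in H are nonlinear Fourier series *)


Section Converse.
Variable R : realType.
Local Notation C := (complex R).
Local Notation D := (@circ R).
Implicit Types (p q : pair R) (F : nat -> C).

Lemma cinvE (z : C) : z^-1 = cconj z * Complex (csq z)^-1 0.
Proof.
have [->|z0] := eqVneq z 0; first by rewrite invr0 cconj0 mul0r.
apply: (mulfI z0); rewrite mulfV // mulrA mul_cconj.
have h := lt0r_neq0 (csq_gt0 z0).
by apply: cext; rewrite !reimE /= ?mulfV //; ring.
Qed.

Lemma cmeas_inv (f : R -> C) : cmeasurable f -> cmeasurable (fun t => (f t)^-1).
Proof.
move=> mf; under eq_fun do rewrite cinvE.
apply: cmeasM; first exact: cmeas_conj.
split; last exact: measurable_cst.
(* Both the inverse and the power -1 take the default value 0 at 0, so the identity holds at every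
   point. *)
rewrite /= (_ : (fun t => _) = (fun x => x `^ (-1)) \o (fun t => csq (f t))).
  by apply: measurableT_comp => //; exact: rmeas_csq.
by apply/funext => t /=; rewrite powR_inv1 // csq_ge0.
Qed.

(** A weighted arithmetic-geometric inequality in place of Cauchy-Schwarz: 2 ||z|^2 - |w|^2| is at
    most |z - w|^2 / e + e |z + w|^2, and z + w = (z - w) + 2 w. It turns L^2 closeness into L^1
    closeness of squared moduli. *)
Lemma csq_dist_le (e : R) (z w : C) : 0 < e ->
  `|csq z - csq w| <= (e^-1 + 2 * e) * csq (z - w) + 8 * e * csq w.
Proof.
move=> e0; have eV : 0 < e^-1 by rewrite invr_gt0.
have ee : e * e^-1 = 1 by rewrite mulfV // lt0r_neq0.
have h1 := mulr_ge0 (ltW e0) (sqr_ge0 (e^-1 * complex.Re (z - w) - complex.Re (z + w))).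
have h2 := mulr_ge0 (ltW e0) (sqr_ge0 (e^-1 * complex.Im (z - w) - complex.Im (z + w))).
have h3 := mulr_ge0 (ltW e0) (sqr_ge0 (e^-1 * complex.Re (z - w) + complex.Re (z + w))).
have h4 := mulr_ge0 (ltW e0) (sqr_ge0 (e^-1 * complex.Im (z - w) + complex.Im (z + w))).
(* The signs s = 1 and s = -1 bound the difference of squared moduli from below and from above. *)
have E (s : R) : s ^+ 2 = 1 ->
   e * (e^-1 * complex.Re (z - w) + s * complex.Re (z + w)) ^+ 2 +
   e * (e^-1 * complex.Im (z - w) + s * complex.Im (z + w)) ^+ 2 =
   e^-1 * csq (z - w) + 2 * s * (csq z - csq w) + e * csq (z + w).
  move=> s2; rewrite /csq !reimE.
  set a := complex.Re z; set b := complex.Im z; set c := complex.Re w; set d := complex.Im w.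
  rewrite [LHS](_ : _ = e * e^-1 * (e^-1 * ((a - c) ^+ 2 + (b - d) ^+ 2) +
     2 * s * ((a - c) * (a + c) + (b - d) * (b + d))) +
     e * s ^+ 2 * ((a + c) ^+ 2 + (b + d) ^+ 2)); last by ring.
  by rewrite ee s2; ring.
have E1 := E 1 (expr1n _ _); have E2 := E (-1) (sqrr_sign _ 1).
rewrite !mulN1r in E2; rewrite !mul1r in E1.
have hD : csq (z + w) <= 2 * csq (z - w) + 8 * csq w.
  have -> : z + w = (z - w) + 2 * w by ring.
  apply: le_trans (csqD_le _ _) _; rewrite csqM (_ : csq (2 : C) = 4); first by lra.
  by rewrite /csq /=; ring.
have hE := ler_wpM2l (ltW e0) hD.
have n1 : 0 <= e^-1 * csq (z - w) by rewrite mulr_ge0 ?csq_ge0 // ltW.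
have n2 : 0 <= e * csq (z - w) by rewrite mulr_ge0 ?csq_ge0 // ltW.
have n3 : 0 <= e * csq w by rewrite mulr_ge0 ?csq_ge0 // ltW.
have E1' : e * csq (z + w) <= 2 * (e * csq (z - w)) + 8 * (e * csq w).
  by apply: le_trans hE _; rewrite mulrDr; lra.
have -> : (e^-1 + 2 * e) * csq (z - w) + 8 * e * csq w =
  e^-1 * csq (z - w) + 2 * (e * csq (z - w)) + 8 * (e * csq w) by ring.
by rewrite ler_norml; apply/andP; split; lra.
Qed.

(** The mean of |det q - 1| is at most a constant depending on e times the distance to [Q n], plus 8
    e. First n tends to infinity, then e to 0. *)
Lemma det_lim (Q : nat -> pair R) q :
  (forall n, L2 (Q n).1) -> (forall n, L2 (Q n).2) -> L2 q.1 -> L2 q.2 ->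
  (forall n, ae_circ (fun t => det (Q n) t = 1)) ->
  dmean (Q n) q @[n --> \oo] --> (0 : R) -> ae_circ (fun t => det q t = 1).
Proof.
move=> Q1 Q2 q1 q2 dQ hc.
have iq : ig (fun t => det q t - 1).
  by apply: igB; [apply: igD; exact: L2_ig|exact: ig_cst].
have iN : ig (fun t => `|det q t - 1|) by exact: integrable_norm iq.
have le (e : R) n : 0 < e ->
    rmean (fun t => `|det q t - 1|) <= (e^-1 + 2 * e) * dmean (Q n) q + 8 * e.
  move=> e0; have [iD eD] := dmeanE q1 q2 (Q1 n) (Q2 n).
  rewrite dmeanC eD -rmeanZ // -[X in _ + X](rmean_cst (8 * e)).
  rewrite -rmeanD; [|exact: igZ|exact: ig_cst].
  apply: rmean_ae_le => //; first by apply: igD; [exact: igZ|exact: ig_cst].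
  apply: ae_circS (dQ n) => t _ d1; rewrite -d1 /det /pairdist.
  have -> : csq (q.1 t) + csq (q.2 t) - (csq ((Q n).1 t) + csq ((Q n).2 t)) =
    (csq (q.1 t) - csq ((Q n).1 t)) + (csq (q.2 t) - csq ((Q n).2 t)) by ring.
  apply: le_trans (ler_normD _ _) _.
  apply: le_trans (lerD (csq_dist_le _ _ e0) (csq_dist_le _ _ e0)) _.
  have d1' : csq ((Q n).2 t) = 1 - csq ((Q n).1 t) by rewrite -d1 /det; ring.
  by rewrite d1' le_eqVlt; apply/orP; left; apply/eqP; ring.
have z : rmean (fun t => `|det q t - 1|) = 0.
  apply/eqP; rewrite eq_le rmean_ge0 ?andbT; last by move=> t _; exact: normr_ge0.
  have step (e : R) : 0 < e -> rmean (fun t => `|det q t - 1|) <= 8 * e.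
    move=> e0.
    have c1 : (e^-1 + 2 * e) * dmean (Q n) q + 8 * e @[n --> \oo] --> (8 * e).
      rewrite -[X in _ --> X]add0r -[X in _ --> X + _](mulr0 (e^-1 + 2 * e)).
      by apply: cvgD; [apply: cvgM => //; exact: cvg_cst|exact: cvg_cst].
    rewrite -(cvg_lim (@Rhausdorff R) c1); apply: limr_ge.
      by apply/cvg_ex; exists (8 * e).
    by apply: nearW => n; exact: le.
  apply/ler_addgt0Pl => e e0; rewrite addr0.
  have /step : 0 < e / 8 by rewrite divr_gt0.
  by rewrite mulrC divfK.
have := rmean_eq0 iN (fun t _ => normr_ge0 _) z.
by apply: ae_circS => t _ /eqP; rewrite normr_eq0 subr_eq0 => /eqP.
Qed.

Lemma nsqM_prod_lim (f : R -> C) (g : nat -> R -> C) h : cmeasurable f ->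
  ae_circ (fun t => csq (f t) <= 1) -> (forall n, L2 (g n)) -> L2 h ->
  nsq (fun t => g n t - h t) @[n --> \oo] --> (0 : R) ->
  nsq (fun t => f t * g n t - f t * h t) @[n --> \oo] --> (0 : R).
Proof.
move=> mf bf hg hh; apply: squeeze0 => [n|]; first exact: nsq_ge0.
apply: nearW => n; under eq_fun do rewrite -mulrBr.
by apply: nsqM_le => //; exact: L2B.
Qed.

Lemma nsqD_lim (f g : nat -> R -> C) u v : (forall n, L2 (f n)) -> (forall n, L2 (g n)) ->
  L2 u -> L2 v ->
  nsq (fun t => f n t - u t) @[n --> \oo] --> (0 : R) ->
  nsq (fun t => g n t - v t) @[n --> \oo] --> (0 : R) ->
  nsq (fun t => (f n t + g n t) - (u t + v t)) @[n --> \oo] --> (0 : R).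
Proof.
move=> hf hg hu hv cf cg.
have c : 2 * nsq (fun t => f n t - u t) + 2 * nsq (fun t => g n t - v t)
    @[n --> \oo] --> (0 : R).
  rewrite -[X in _ --> X](addr0 0) -{1}(mulr0 2) -{2}(mulr0 2).
  by apply: cvgD; apply: cvgM => //; exact: cvg_cst.
apply: (squeeze0 _ _ c) => [n|]; first exact: nsq_ge0.
apply: nearW => n; have := nsqD (L2B (hf n) hu) (L2B (hg n) hv).
by congr (is_true (nsq _ <= _)); apply/funext => t; rewrite opprD addrACA.
Qed.

(** * The limit of the stripped pairs *)

Section Limit.
Variable p : pair R.
Hypothesis hp : prehbar p.
Let F := layer_strip p.
Let G n := prodfrom F 0 n.
Let Q n := twist n (strip_pair p n).

Lemma L2_twist n : L2 (Q n).1 /\ L2 (Q n).2.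
Proof.
by have [l1 l2] := ph_L2 (prehbar_strip_pair n hp); split => //; exact: L2_expkM.
Qed.

Lemma det_twist n : ae_circ (fun t => det (Q n) t = 1).
Proof.
apply: ae_circS (ph_det (prehbar_strip_pair n hp)) => t _.
by rewrite /det /= csqM csq_expk mulr1.
Qed.

Lemma twistE n : Q n = pmul (pairinv (G n)) p.
Proof.
rewrite -[X in _ = pmul _ X](twist_strip_pair p n) pmul_pairinvK //.
by move=> t; exact: det_prodfrom.
Qed.

(** Inversion and right multiplication by p are isometries almost everywhere, so the stripped pairs
    have the same mutual distances as the partial products. *)
Lemma dmean_twist m n : dmean (Q (m + n)) (Q m) = 2 - 2 * nfprod F m n.
Proof.
have [a1 a2] := L2_twist (m + n); have [b1 b2] := L2_twist m.
have [c1 c2] := L2_prodfrom F 0 (m + n); have [d1 d2] := L2_prodfrom F 0 m.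
rewrite -dmean_prodfrom; have [i ->] := dmeanE a1 a2 b1 b2.
have [j ->] := dmeanE c1 c2 d1 d2; apply: rmean_ae; try exact: ig_meas.
apply: ae_circS (ph_det hp) => t _ h.
by rewrite !twistE pairdist_pmulr pairdist_pairinv h mulr1.
Qed.

Lemma nfprod_nincr m n : (m <= n)%N -> nfprod F 0 n <= nfprod F 0 m.
Proof.
move=> /subnKC <-; rewrite nfprod_cat ler_piMr //; first exact: ltW (nfprod_gt0 _ _ _).
exact: nfprod_le1.
Qed.

Lemma nfprod_lb n : csq (at0 (fstar p.1)) <= nfprod F 0 n.
Proof.
apply: le_trans (csq_at0_le n hp) _; rewrite expr2 ler_piMr //.
  exact: ltW (nfprod_gt0 _ _ _).
exact: nfprod_le1.
Qed.

Lemma nfprod_is_cvg : exists2 l, csq (at0 (fstar p.1)) <= l &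
  nfprod F 0 n @[n --> \oo] --> l.
Proof.
have c : cvgn (nfprod F 0).
  apply: nonincreasing_is_cvgn; first by move=> m n; exact: nfprod_nincr.
  by exists (csq (at0 (fstar p.1))) => _ [n _ <-]; exact: nfprod_lb.
exists (limn (nfprod F 0)) => //; apply: limr_ge => //.
by apply: nearW => n; exact: nfprod_lb.
Qed.

Lemma twist_cauchy (e : R) : 0 < e -> exists N, forall m n, (N <= m)%N -> (N <= n)%N ->
  dmean (Q m) (Q n) <= e.
Proof.
move=> e0; have [l _ cl] := nfprod_is_cvg; set a := csq (at0 (fstar p.1)).
have a0 : 0 < a by apply: csq_gt0; exact: ph_at0.
(* With x the product up to m and y the tail, the distance is 2 (1 - y) and 2 (x - x y) <= 4 (e a /
   4) = e a <= e x. Dividing by x uses the positive lower bound a. *)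
have /cvgrPdist_le/(_ (e * a / 4)) := cl.
rewrite divr_gt0 ?mulr_gt0 // => /(_ isT)[N _ hN]; exists N.
have H m n : (N <= m)%N -> (m <= n)%N -> dmean (Q n) (Q m) <= e.
  move=> Nm /subnKC <-; set k := (n - m)%N; rewrite dmean_twist.
  have h1 := hN m Nm; have h2 := hN (m + k)%N (leq_trans Nm (leq_addr _ _)).
  move: h1 h2; rewrite /= !ler_norml nfprod_cat => /andP[h1 h2] /andP[h3 h4].
  have P0 : 0 < nfprod F 0 m by exact: nfprod_gt0.
  have aP : a <= nfprod F 0 m by exact: nfprod_lb.
  have eP := ler_wpM2l (ltW e0) aP.
  rewrite -(ler_pM2r P0); move: h1 h2 h3 h4 eP.
  set x := nfprod F 0 m; set y := nfprod F m k => h1 h2 h3 h4 eP.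
  have -> : (2 - 2 * y) * x = 2 * (x - x * y) by ring.
  by lra.
move=> m n Nm Nn; case/orP: (leq_total n m) => mn; first exact: H.
by rewrite dmeanC; exact: H.
Qed.

Lemma twist_lim : exists q : pair R, [/\ L2 q.1, L2 q.2, ae_circ (fun t => q.2 t = 0),
  ae_circ (fun t => csq (q.1 t) = 1) & dmean (Q n) q @[n --> \oo] --> (0 : R)].
Proof.
have C1 e : 0 < e -> exists N, forall m n, (N <= m)%N -> (N <= n)%N ->
     nsq (fun t => (Q m).1 t - (Q n).1 t) <= e.
  move=> /twist_cauchy[N hN]; exists N => m n Nm Nn; apply: le_trans (hN m n Nm Nn).
  by have [] := dmean_nsq (Q m) (Q n).
have C2 e : 0 < e -> exists N, forall m n, (N <= m)%N -> (N <= n)%N ->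
     nsq (fun t => (Q m).2 t - (Q n).2 t) <= e.
  move=> /twist_cauchy[N hN]; exists N => m n Nm Nn; apply: le_trans (hN m n Nm Nn).
  by have [] := dmean_nsq (Q m) (Q n).
have L1 n : L2 (Q n).1 by have [] := L2_twist n.
have L2' n : L2 (Q n).2 by have [] := L2_twist n.
have [c hc cc] := L2_complete L1 C1; have [d hd cd] := L2_complete L2' C2.
have cD : dmean (Q n) (c, d) @[n --> \oo] --> (0 : R).
  by rewrite /dmean -[X in _ --> X](addr0 0); exact: cvgD.
have d0 : ae_circ (fun t => d t = 0).
  apply: fcoef_inj0 => // k; apply: (fcoef_lim L2' hd cd).
  (* The second entry of [Q n] carries the factor z^n, so for n > |k| its coefficient at k is one of
     negative index of a function in H^2(D). *)
  exists `|k|.+1%N => // n /= kn; rewrite fcoef_shift.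
  have [_ h] := ph_2 (prehbar_strip_pair n hp); apply: h; lia.
exists (c, d); split => //.
have := @det_lim _ (c, d) L1 L2' hc hd det_twist cD.
move=> h; apply: (ae_circS2 _ h d0) => t _ h1 h0; move: h1.
by rewrite /det -[(c, d).2 t]/(d t) h0 csq0 addr0.
Qed.

End Limit.

(** Here A_n(0) is a / [nfprod F 0 n] and tends to a / l, so the point is that the product attains
    the value a. The ratio a / l is the value at 0 of an inner function dividing the pair; since the
    pair is in H, this function is constant, and a positive unimodular number is 1. *)
Lemma inH_at0_cvg p : inH p ->
  complex.Re (at0 (fstar (strip_pair p n).1)) @[n --> \oo] --> (1 : R).
Proof.
move=> [[hL h2] hin]; have hp := prehbar_inL hL h2; have [ea a0] := inL_at0 hL.
set F := layer_strip p; set a := complex.Re (at_infty p.1) in ea a0.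
have ex n : complex.Re (at0 (fstar (strip_pair p n).1)) = (nfprod F 0 n)^-1 * a.
  by rewrite strip_pair_at0 // ea !reimE /= mulr0 subr0.
have exI n : complex.Im (at0 (fstar (strip_pair p n).1)) = 0.
  by rewrite strip_pair_at0 // ea !reimE /= mulr0 mul0r addr0.
have [l la cl] := nfprod_is_cvg hp.
have l0 : 0 < l by apply: lt_le_trans la; apply: csq_gt0; exact: ph_at0.
have cx : complex.Re (at0 (fstar (strip_pair p n).1)) @[n --> \oo] --> l^-1 * a.
  under eq_fun do rewrite ex; apply: cvgM; last exact: cvg_cst.
  by apply: cvgV => //; exact: lt0r_neq0.
suff -> : 1 = l^-1 * a by [].
have [q [q1 q2 z2 u1 cq]] := twist_lim hp.
pose Q n := twist n (strip_pair p n).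
have [c1 c2] := dmean_cvg cq.
have LQ n : L2 (Q n).1 /\ L2 (Q n).2 by exact: L2_twist.
have [p1 p2] := ph_L2 hp; have [m1 _] := p1; have [m2 _] := p2.
have cs : nsq (fun t => fstar (strip_pair p n).1 t - fstar q.1 t) @[n --> \oo] --> (0 : R).
  move: c1; rewrite (_ : (fun n => nsq (fun t => fstar _ t - _)) =
    (fun n => nsq (fun t => (Q n).1 t - q.1 t))) //.
  apply/funext => n; rewrite /nsq; congr rmean; apply/funext => t.
  by rewrite /fstar -cconjN -cconjD csq_conj.
pose g := fstar q.1.
have hg : H2D g.
  apply: (@H2D_lim _ (fun n => fstar (strip_pair p n).1)) => //.
    by move=> n; exact: ph_star1 (prehbar_strip_pair n hp).
  exact: L2_conj.
have ug : ae_circ (fun t => csq (g t) = 1).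
  by apply: ae_circS u1 => t _; rewrite /g /fstar csq_conj.
have [lg _] := hg; have mg := L2_meas lg.
have giE : ae_circ (fun t => (g t)^-1 = q.1 t).
  by apply: ae_circS ug => t _ /cinv_unimodular ->; rewrite /g /fstar cconjK.
have mgi := cmeas_inv mg.
have b1 : ae_circ (fun t => csq (p.1 t) <= 1).
  by apply: ae_circS (ph_det hp) => t _ /csq_le_det[].
have b2 : ae_circ (fun t => csq (p.2 t) <= 1).
  by apply: ae_circS (ph_det hp) => t _ /csq_le_det[].
have bc1 : ae_circ (fun t => csq (cconj (p.1 t)) <= 1).
  by apply: ae_circS b1 => t _; rewrite csq_conj.
have bc2 : ae_circ (fun t => csq (cconj (p.2 t)) <= 1).
  by apply: ae_circS b2 => t _; rewrite csq_conj.
have bn1 : ae_circ (fun t => csq (- p.1 t) <= 1).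
  by apply: ae_circS b1 => t _; rewrite csqN.
have mc1 := cmeas_conj m1; have mc2 := cmeas_conj m2; have mn1 := cmeasN m1.
have LQ1 n : L2 (Q n).1 by have [] := LQ n.
have LQ2 n : L2 (Q n).2 by have [] := LQ n.
(* The partial products are [p (Q n)^-1], which converges to [p q^-1 = (p.1 / q.1, p.2 q.1)]. *)
have pG n : ae_circ (fun t => (prodfrom F 0 n).1 t =
    p.1 t * cconj ((Q n).1 t) + p.2 t * cconj ((Q n).2 t) /\
    (prodfrom F 0 n).2 t = p.2 t * (Q n).1 t + - p.1 t * (Q n).2 t).
  apply: ae_circS (det_twist hp n) => t _ d1.
  have [-> ->] := pmulK_at (prodfrom F 0 n) d1; rewrite twist_strip_pair.
  rewrite -[(pmul _ _).1 t]/(p.1 t * cconj ((Q n).1 t) - p.2 t * cconj (- (Q n).2 t)).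
  rewrite -[(pmul _ _).2 t]/(p.1 t * - (Q n).2 t + p.2 t * cconj (cconj ((Q n).1 t))).
  by rewrite cconjN cconjK; split; ring.
have hgA : H2D (fun t => fstar p.1 t / g t).
  (* Almost everywhere [u n] is the conjugated first entry of a partial product, hence a polynomial
     in z. The entries of p are bounded by 1, so its L^2 limit is obtained by replacing [Q n] with
     q. *)
  pose u n t := cconj (p.1 t) * (Q n).1 t + cconj (p.2 t) * (Q n).2 t.
  have hu n : H2D (u n).
    apply: (H2D_ae _ (ps_star1 (prodfrom_spectrum F 0 n))).
      by apply: cmeasD; apply: cmeasM => //; exact: L2_meas.
    by apply: ae_circS (pG n) => t _ [h _]; rewrite /fstar h cconjD !cconjM !cconjK.
  have la' : L2 (fun t => cconj (p.1 t) * q.1 t) by exact: (L2M_bounded mc1 bc1 q1).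
  have lb' : L2 (fun t => cconj (p.2 t) * q.2 t) by exact: (L2M_bounded mc2 bc2 q2).
  have hlim : H2D (fun t => cconj (p.1 t) * q.1 t + cconj (p.2 t) * q.2 t).
    apply: (H2D_lim hu); first exact: L2D.
    apply: (nsqD_lim _ _ la' lb').
    - by move=> n; exact: (L2M_bounded mc1 bc1 (LQ1 n)).
    - by move=> n; exact: (L2M_bounded mc2 bc2 (LQ2 n)).
    - exact: (nsqM_prod_lim mc1 bc1 LQ1 q1 c1).
    - exact: (nsqM_prod_lim mc2 bc2 LQ2 q2 c2).
  apply: (H2D_ae _ hlim); first by apply: cmeasM => //; exact: mc1.
  by apply: (ae_circS2 _ z2 giE) => t _ -> ->; rewrite mulr0 addr0.
have hgB : H2D (fun t => p.2 t / g t).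
  pose u n t := p.2 t * (Q n).1 t + - p.1 t * (Q n).2 t.
  have hu n : H2D (u n).
    apply: (H2D_ae _ (H2D_prodfrom2 F 0 n)).
      by apply: cmeasD; apply: cmeasM => //; exact: L2_meas.
    by apply: ae_circS (pG n) => t _ [_ h].
  have la' : L2 (fun t => p.2 t * q.1 t) by exact: (L2M_bounded m2 b2 q1).
  have lb' : L2 (fun t => - p.1 t * q.2 t) by exact: (L2M_bounded mn1 bn1 q2).
  have hlim : H2D (fun t => p.2 t * q.1 t + - p.1 t * q.2 t).
    apply: (H2D_lim hu); first exact: L2D.
    apply: (nsqD_lim _ _ la' lb').
    - by move=> n; exact: (L2M_bounded m2 b2 (LQ1 n)).
    - by move=> n; exact: (L2M_bounded mn1 bn1 (LQ2 n)).
    - exact: (nsqM_prod_lim m2 b2 LQ1 q1 c1).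
    - exact: (nsqM_prod_lim mn1 bn1 LQ2 q2 c2).
  apply: (H2D_ae _ hlim); first exact: cmeasM.
  by apply: (ae_circS2 _ z2 giE) => t _ -> ->; rewrite mulr0 addr0.
have [c gc] := hin g (conj hg ug) hgA hgB.
have gc0 : at0 g = c.
  by rewrite at0E // -[RHS]cmean_cst; apply: cmean_ae => //; exact: cmeas_cst.
have ls n : L2 (fstar (strip_pair p n).1).
  by have [] := ph_star1 (prehbar_strip_pair n hp).
(* Taking means turns the almost-everywhere statement about a constant into an equality. *)
have csqc : csq c = 1.
  have h : ae_circ (fun t : R => csq c = 1).
    by apply: (@ae_circS2 R _ _ (fun=> csq c = 1) _ gc ug) => t _ <-.
  rewrite -[LHS](@rmean_cst R) -[RHS](@rmean_cst R).
  by apply: rmean_ae => //; exact: measurable_cst.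
have ccE : c = Complex (l^-1 * a) 0.
  apply/eqP; rewrite -subr_eq0; apply/eqP.
  pose x n := complex.Re (at0 (fstar (strip_pair p n).1)).
  (* The value g(0) is compared with a / l through A_n(0), which is close to the first by L^2
     convergence and to the second by convergence of the products. *)
  have cv : 2 * nsq (fun t => fstar (strip_pair p n).1 t - fstar q.1 t) +
      2 * (x n - l^-1 * a) ^+ 2 @[n --> \oo] --> (0 : R).
    have h0 : x n - l^-1 * a @[n --> \oo] --> (0 : R).
      by rewrite -(subrr (l^-1 * a)); apply: cvgB => //; exact: cvg_cst.
    rewrite -[X in _ --> X](addr0 0) -{1}(mulr0 2) -{2}(mulr0 2).
    apply: cvgD; apply: cvgM => //; try exact: cvg_cst.
    by under eq_fun do rewrite expr2; rewrite -(mulr0 0); exact: cvgM.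
  apply: (csq_lim0 _ cv); apply: nearW => n.
  have -> : c - Complex (l^-1 * a) 0 =
      (c - at0 (fstar (strip_pair p n).1)) + Complex (x n - l^-1 * a) 0.
    move: (exI n); rewrite /x; move: (at0 (fstar _)) => y yI.
    by apply: cext; rewrite !reimE ?yI /=; ring.
  apply: le_trans (csqD_le _ _) _; rewrite csq_real lerD2r ler_pM2l //.
  rewrite -gc0 -csqN opprB /at0 -fcoefB //.
  by apply: csq_fcoef_le; exact: L2B.
have : (l^-1 * a) ^+ 2 = 1 by rewrite -csqc ccE csq_real.
have pos : 0 < l^-1 * a by rewrite mulr_gt0 ?invr_gt0.
move=> /eqP; rewrite sqrf_eq1 => /orP[/eqP->//|/eqP h].
by move: pos; rewrite h; lra.
Qed.

Lemma norm_lnB (x y : R) : 0 < x -> 0 < y -> `|ln x - ln y| = `|ln (x^-1 * y)|.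
Proof.
by move=> x0 y0; rewrite lnM ?posrE ?invr_gt0 // lnV ?posrE // distrC addrC.
Qed.

(** Both parts of [rho] are governed by A_n(0): the squared L^2 distance is 2 - 2 Re A_n(0), and the
    logarithmic term is |log A_n(0)|. *)
Lemma nlfs_inH p : inH p -> is_NLFS (layer_strip p) p.
Proof.
move=> hH; have [[hL h2] _] := hH; split => //; have hp := prehbar_inL hL h2.
have [ea a0] := inL_at0 hL; set F := layer_strip p.
have cx := inH_at0_cvg hH; set a := complex.Re (at_infty p.1) in ea a0.
have ex n : complex.Re (at0 (fstar (strip_pair p n).1)) = (nfprod F 0 n)^-1 * a.
  by rewrite strip_pair_at0 // ea !reimE /= mulr0 subr0.
have cD : dmean (prodfrom F 0 n) p @[n --> \oo] --> (0 : R).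
  under eq_fun do rewrite dmeanC dmean_strip //.
  have e0 : 0 = 2 - 2 * 1 :> R by ring.
  rewrite e0; apply: cvgB; first exact: cvg_cst.
  by apply: cvgM => //; exact: cvg_cst.
have [c1 c2] := dmean_cvg cD.
have sq (f : nat -> R -> C) : nsq (f n) @[n --> \oo] --> (0 : R) ->
    L2norm (f n) @[n --> \oo] --> (0 : R).
  move=> h; under eq_fun do rewrite L2normE.
  rewrite -(@sqrtr0 R); exact: (cvg_comp _ _ h (@sqrt_continuous R 0)).
have cl : `|ln (nfprod F 0 n) - ln a| @[n --> \oo] --> (0 : R).
  have e n : `|ln (nfprod F 0 n) - ln a| =
      `|ln (complex.Re (at0 (fstar (strip_pair p n).1)))|.
    by rewrite ex norm_lnB ?nfprod_gt0.
  under eq_fun do rewrite e; rewrite -(@normr0 _ R); apply: cvg_norm.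
  rewrite -(@ln1 R); exact: (cvg_comp _ _ cx (@continuous_ln R 1 ltr01)).
pose X m := L2norm (fun t => (prodfrom F 0 m).1 t - p.1 t) +
  L2norm (fun t => (prodfrom F 0 m).2 t - p.2 t) + `|ln (nfprod F 0 m) - ln a|.
have cX : X m @[m --> \oo] --> (0 : R).
  by have := cvgD (cvgD (sq _ c1) (sq _ c2)) cl; rewrite !addr0; exact.
rewrite (_ : (fun k => rho _ p) = (fun n => X n.+1)); first by rewrite cvg_shiftS.
by apply/funext => n; rewrite /X /rho nlf_partialE Re_at_infty_prodfrom.
Qed.

End Converse.

Theorem theorem6p4 (R : realType) :
  (forall (F : nat -> R[i]), sqsum F ->
     forall p : pair R, is_NLFS F p ->
       (forall n, layer_strip p n = F n) /\ inH p) /\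
  (forall p : pair R, inH p ->
     sqsum (layer_strip p) /\ is_NLFS (layer_strip p) p).
Proof.
split=> [F _ p hF|p hp].
  by split; [exact: layer_strip_nlfs|exact: inH_nlfs hF].
split; last exact: nlfs_inH.
by have [[hL h2] _] := hp; apply: sqsum_strip; exact: prehbar_inL.
Qed.
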